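(* Let $M_t$, $t\in[0,T)$, be a family of smooth closed strictly convex surfaces in $\mathbb{R}^3$ flowing according to $\frac{d}{dt}X=-|A|^4\nu=-(|A|^2)^2\nu$. Then $$\max_{M_t}\frac{(\lambda_1^4+2\lambda_1^3\lambda_2+4\lambda_1^2\lambda_2^2+2\lambda_1\lambda_2^3+\lambda_2^4)(\lambda_1-\lambda_2)^2}{(\lambda_1+\lambda_2)\lambda_1\lambda_2}$$ is non-increasing in time.
   Context: A closed surface is a compact connected embedded surface without boundary. $X=X(x,t)$ is the (smooth) embedding vector of $M_t$ into $\mathbb{R}^3$, $\frac{d}{dt}X$ its total time derivative, and $\nu$ the outer unit normal to $M_t$. The principal curvatures $\lambda_1,\lambda_2$ are the eigenvalues of the second fundamental form with respect to the induced metric, with sign such that round spheres have positive principal curvatures. A surface is strictly convex if all its principal curvatures are strictly positive. $|A|^2=\lambda_1^2+\lambda_2^2$. *)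

(* Defs.v *)
From HB Require Import structures.
From mathcomp Require Import all_boot all_order all_algebra.
From mathcomp Require Import all_classical all_reals all_analysis.

Set Implicit Arguments.
Unset Strict Implicit.
Unset Printing Implicit Defensive.

Import Order.TTheory GRing.Theory Num.Theory.
Import numFieldNormedType.Exports.

Local Open Scope classical_set_scope.
Local Open Scope ring_scope.

(* For V finite-dimensional and U open this is the usual class C^k(U, W). *)
Fixpoint Ck (R : realType) (V W : normedModType R) (k : nat)
    (U : set V) (f : V -> W) : Prop :=
  match k with
  | 0%N => forall x, U x -> {for x, continuous f}
  | k'.+1 => (forall x, U x -> differentiable f x) /\
             (forall v : V, Ck k' U (fun x => 'D_v f x))
  end.

Definition Cinfty (R : realType) (V W : normedModType R)
    (U : set V) (f : V -> W) : Prop :=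
  forall k, Ck k U f.

(* Smoothness on an arbitrary subset A: near each point of A, f agrees on A
   with a smooth function defined on an open set of the ambient space. *)
Definition smooth_on (R : realType) (V W : normedModType R)
    (A : set V) (f : V -> W) : Prop :=
  forall x, A x -> exists (U : set V) (g : V -> W),
    [/\ open U, U x, Cinfty U g & forall y, A y -> U y -> f y = g y].

Definition diffeomorphism (R : realType) (V W : normedModType R)
    (A : set V) (B : set W) (f : V -> W) : Prop :=
  exists g : W -> V,
    [/\ smooth_on A f, smooth_on B g,
        forall x, A x -> B (f x) /\ g (f x) = x
      & forall y, B y -> A (g y) /\ f (g y) = y].

Definition local_param (R : realType) (S : set 'rV[R]_3)
    (U : set 'rV[R]_2) (phi : 'rV[R]_2 -> 'rV[R]_3) : Prop :=
  open U /\ exists W : set 'rV[R]_3,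
    open W /\ diffeomorphism U (S `&` W) phi.

Definition embedded_surface (R : realType) (S : set 'rV[R]_3) : Prop :=
  forall p, S p -> exists (U : set 'rV[R]_2) (phi : 'rV[R]_2 -> 'rV[R]_3),
    local_param S U phi /\ exists2 u, U u & phi u = p.

(* The library's [connected] holds of the empty set. *)
Definition closed_surface (R : realType) (S : set 'rV[R]_3) : Prop :=
  [/\ S !=set0, compact S, connected S & embedded_surface S].

(* The norm of 'rV[R]_3 in the library is the sup norm, so the Euclidean
   structure is introduced separately. *)
Definition dot (R : realType) (n : nat) (u v : 'rV[R]_n) : R :=
  \sum_i u 0 i * v 0 i.

(* The union of the unbounded components of the complement of S. *)
Definition exterior (R : realType) (S : set 'rV[R]_3) : set 'rV[R]_3 :=
  [set x | ~ S x /\ ~ bounded_set (connected_component (~` S) x)].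

Definition outer_unit_normal (R : realType) (S : set 'rV[R]_3)
    (p n : 'rV[R]_3) : Prop :=
  [/\ dot n n = 1,
      forall U phi u, local_param S U phi -> U u -> phi u = p ->
        forall v, dot n ('D_v phi u) = 0
    & \forall s \near (0 : R)^'+, exterior S (p + s *: n)].

Definition first_form (R : realType) (phi : 'rV[R]_2 -> 'rV[R]_3)
    (u : 'rV[R]_2) : 'M[R]_2 :=
  \matrix_(i, j) dot ('D_('e_i) phi u) ('D_('e_j) phi u).

(* With the minus sign and n the outer normal, round spheres have positive
   principal curvatures. *)
Definition second_form (R : realType) (phi : 'rV[R]_2 -> 'rV[R]_3)
    (n : 'rV[R]_3) (u : 'rV[R]_2) : 'M[R]_2 :=
  \matrix_(i, j) - dot ('D_('e_i) (fun w => 'D_('e_j) phi w) u) n.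

(* a and b are the eigenvalues, with multiplicity and in either order, of the
   second fundamental form with respect to the induced metric at the point p
   of S, n being the normal at p.  The characteristic polynomial does not
   depend on the local parametrization. *)
Definition principal_curvatures (R : realType) (S : set 'rV[R]_3)
    (n p : 'rV[R]_3) (a b : R) : Prop :=
  forall U phi u, local_param S U phi -> U u -> phi u = p ->
    char_poly (invmx (first_form phi u) *m second_form phi n u)
    = ('X - a%:P) * ('X - b%:P).

(* Derivative at t of f restricted to I; one-sided at an endpoint of I. *)
Definition has_derivative_within (R : realType) (V : normedModType R)
    (I : set R) (f : R -> V) (t : R) (v : V) : Prop :=
  (fun s => (s - t)^-1 *: (f s - f t)) @ within I t^' --> v.

Definition is_max (R : realType) (A : set R) (m : R) : Prop :=
  A m /\ ubound A m.

Definition normA2 (R : realType) (a b : R) : R := a ^+ 2 + b ^+ 2.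

Definition pinching (R : realType) (a b : R) : R :=
  (a ^+ 4 + 2 * a ^+ 3 * b + 4 * a ^+ 2 * b ^+ 2 + 2 * a * b ^+ 3 + b ^+ 4)
  * (a - b) ^+ 2 / ((a + b) * a * b).

(* Main.v *)
Require Import Defs.
From HB Require Import structures.
From mathcomp Require Import all_boot all_order all_algebra.
From mathcomp Require Import all_classical all_reals all_analysis.
From mathcomp Require Import ring lra.
Set Implicit Arguments.
Unset Strict Implicit.
Unset Printing Implicit Defensive.
Import Order.TTheory GRing.Theory Num.Theory.
Import numFieldNormedType.Exports.
Local Open Scope classical_set_scope.
Local Open Scope ring_scope.

(** Write a, b for the principal curvatures, H = a + b, K = a b, F = |A|^4 for the
    speed, and w for the pinching quantity, which is nonnegative.  The maximum of w
    cannot increase, by the parabolic maximum principle: if it did, then for a small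
    e > 0 the function w - e t would have a maximum over space and a time interval
    at a time t > 0 and at a point where w > 0 ([maximum_principle]).  There w is
    spatially maximal and has time derivative at least e; this is impossible
    because the time derivative of w is nonpositive wherever w is spatially maximal
    and positive ([interior_decrease]).

    At such a point a <> b.  Choose two directions in the parameter plane for which
    the metric is the identity and the second fundamental form is diag(a, b)
    ([diagonalize]), and rotate space so that the tangent vectors and the normal
    become the coordinate axes ([orthonormal_frame]).  Indices after a semicolon
    denote covariant derivatives in these directions.  The flow gives
      H_t = F_;11 + F_;22 + F (a^2 + b^2),   K_t = b F_;11 + a F_;22 + F H K,
    and the fourth derivatives of the embedding enter the Hessians of H and K only
    through h_11;11, h_11;22, h_22;22 and h_22;11 = h_11;22 - a b (a - b), the last
    equation being Simons' identity.  Since the gradient of w vanishes, the third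
    order terms h_ij;k reduce to two real parameters, and
      w_t = F_a w_;11 + F_b w_;22 - (zero order term) - (two squares).
    The Hessian terms are nonpositive at a maximum, the zero order term is a
    positive multiple of (a - b)^2, and the coefficients of the squares are positive
    multiples of a form of degree 22 in a and b that is nonnegative for a, b > 0
    ([gradient_form_ge0], [pinching_inequality], [pinching_decreases]).

    The derivatives at the chosen point are read off from second-order Taylor
    expansions along three lines, two in space and one in time.  Expansions can be
    multiplied and inverted and their coefficients are unique, so that each pointwise
    identity of surface theory becomes three equations between coefficients
    ([line_jets]).  The tangential parts of the second and third derivatives of the
    embedding stay in these equations as free variables and cancel in the end; this
    takes the place of normal coordinates.  The analysis behind it is the symmetry of
    second derivatives ([derive_comm]) and Taylor's formula ([Ck_jet]).

    The hypotheses do not provide any regularity of the unit normal n in time, nor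
    of a and b.  But H^2 and K depend on n only through products of two of its
    components, and these are rational functions of the first derivatives of the
    embedding X; hence F is a rational function of derivatives of X, and
    n = - X_t / F inherits its regularity ([cal_normal]).  The same argument, run with
    continuity in place of Taylor expansions, shows that w is continuous up to t = 0
    ([pinching_continuous]), so that the maxima exist. *)

(** * Closure properties of functions of class C^k *)

Section CkCalculus.
Variable R : realType.
Implicit Types V W Z : normedModType R.

(** The difference of the two functions vanishes near x, so its differential is 0. *)
Lemma near_eq_differentiable V W (f g : V -> W) x :
  {near x, f =1 g} -> differentiable f x -> differentiable g x.
Proof.
move=> fg df; have -> : g = f + (g - f) by rewrite addrC subrK.
apply: differentiableD => //.
have fgx : f x = g x by exact: (nbhs_singleton fg).
have fg0 : \forall y \near (0 : V), f (y + x) = g (y + x).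
  by have := fg; rewrite (near_shift 0 x) subr0.
have E : (g - f) \o shift x = cst ((g - f) x) + (\0 : V -> W) +o_ 0 id.
  apply/eqaddoP => _/posnumP[e]; near=> y => /=.
  rewrite !fctE /= !addr0 fgx subrr subr0.
  have -> : f (y + x) = g (y + x) by near: y.
  by rewrite subrr normr0 mulr_ge0.
have c0 : continuous (\0 : V -> W) by move=> ?; exact: cvg_cst.
have d0 : 'd (g - f) x = \0 :> (V -> W).
  exact: (@diff_unique R V W (g - f) \0 x).
by apply/diff_locallyP; rewrite d0.
Unshelve. all: by end_near. Qed.

Lemma Ck_sub V W k (U U' : set V) (f : V -> W) :
  U' `<=` U -> Ck k U f -> Ck k U' f.
Proof.
elim: k f => [|k IH] f UU' /=; first by move=> cf x /UU'; exact: cf.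
by move=> [df Df]; split=> [x /UU'|v]; [exact: df|exact: IH].
Qed.

Lemma open_near V (U : set V) (P : V -> Prop) x : open U -> U x ->
  (forall y, U y -> P y) -> \forall y \near x, P y.
Proof. by move=> oU Ux UP; apply: filterS (open_nbhs_nbhs (conj oU Ux)). Qed.

Lemma Ck_eq V W k (U : set V) (f g : V -> W) : open U ->
  (forall x, U x -> f x = g x) -> Ck k U f -> Ck k U g.
Proof.
move=> oU; elim: k f g => [|k IH] f g fg /=.
  move=> cf x Ux; have fgx := open_near oU Ux fg.
  have : g @ x --> g x; last by [].
  rewrite -(fg x Ux); apply: cvg_trans (cf x Ux).
  by apply: near_eq_cvg; apply: filterS fgx.
move=> [df Df]; split=> [x Ux|v].
  by apply: near_eq_differentiable (df x Ux); exact: open_near oU Ux fg.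
apply: IH (Df v) => x Ux; apply: near_eq_derive.
exact: open_near oU Ux fg.
Qed.

Lemma CkW V W k (U : set V) (f : V -> W) : Ck k.+1 U f -> Ck k U f.
Proof.
elim: k f => [|k IH] f /=.
  by move=> [df _] x Ux; apply: differentiable_continuous; exact: df.
by move=> [df Df]; split=> // v; exact: IH.
Qed.

Lemma Ck_cst V W k (U : set V) (c : W) : Ck k U (fun=> c).
Proof.
elim: k c => [|k IH] c /=; first by move=> x _; exact: cvg_cst.
split=> [x _|v]; first exact: differentiable_cst.
have -> : (fun x => 'D_v (fun=> c) x) = (fun=> 0 : W).
  by apply/funext => x; rewrite derive_cst.
exact: IH.
Qed.

Lemma Ck_add V W k (U : set V) (f g : V -> W) : open U ->
  Ck k U f -> Ck k U g -> Ck k U (fun x => f x + g x).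
Proof.
move=> oU; elim: k f g => [|k IH] f g /=.
  by move=> cf cg x Ux; apply: cvgD; [exact: cf|exact: cg].
move=> [df Df] [dg Dg]; split=> [x Ux|v].
  by apply: differentiableD; [exact: df|exact: dg].
apply: (Ck_eq oU) (IH _ _ (Df v) (Dg v)) => x Ux.
by rewrite deriveD//; apply: diff_derivable; [exact: df|exact: dg].
Qed.

Lemma Ck_sum V W k n (U : set V) (f : 'I_n -> V -> W) : open U ->
  (forall i, Ck k U (f i)) -> Ck k U (fun x => \sum_i f i x).
Proof.
move=> oU; elim: n f => [|n IH] f Cf.
  by apply: (Ck_eq oU) (Ck_cst _ _ (0 : W)) => x _; rewrite big_ord0.
have C1 : Ck k U (fun x => f ord0 x + \sum_i f (lift ord0 i) x).
  by apply: Ck_add => //; exact: IH.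
by apply: (Ck_eq oU) C1 => x _; rewrite big_ord_recl.
Qed.

Lemma diff_linear_post V W Z (l : {linear W -> Z}) (f : V -> W) x v :
  continuous l -> differentiable f x ->
  differentiable (fun y => l (f y)) x /\
  'D_v (fun y => l (f y)) x = l ('D_v f x).
Proof.
move=> cl df; have dl := linear_differentiable (f x) cl.
have dlf : differentiable (fun y => l (f y)) x.
  exact: (@differentiable_comp _ _ _ _ f l).
split=> //; rewrite !deriveE//.
rewrite (_ : (fun y => l (f y)) = l \o f)// diff_comp//=.
by rewrite [in LHS]diff_lin.
Qed.

Lemma Ck_linear_post V W Z k (U : set V) (l : {linear W -> Z}) (f : V -> W) :
  open U -> continuous l -> Ck k U f -> Ck k U (fun x => l (f x)).
Proof.
move=> oU cl; elim: k f => [|k IH] f /=.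
  by move=> cf x Ux; apply: continuous_comp; [exact: cf|exact: cl].
move=> [df Df]; split=> [x Ux|v].
  by have [] := diff_linear_post 0 cl (df x Ux).
apply: (Ck_eq oU) (IH _ (Df v)) => x Ux.
by have [_ ->] := diff_linear_post v cl (df x Ux).
Qed.

Lemma scaler_is_bilinear W : bilinear_for
    (GRing.Scale.Law.clone _ _ *:%R _) (GRing.Scale.Law.clone _ _ *:%R _)
    (@GRing.scale R W).
Proof.
split=> [u'|u] a x y /=.
- by rewrite scalerDl scalerA.
- by rewrite scalerDr !scalerA mulrC.
Qed.

(** Makes the differential of bilinear maps available for the product of a scalar
    function and a vector function. *)
HB.instance Definition _ W := bilinear_isBilinear.Build R R W W _ _
  (@GRing.scale R W) (@scaler_is_bilinear W).

Lemma diff_scale V W (k : V -> R) (f : V -> W) x v :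
  differentiable k x -> differentiable f x ->
  differentiable (fun y => k y *: f y) x /\
  'D_v (fun y => k y *: f y) x = k x *: 'D_v f x + 'D_v k x *: f x.
Proof.
move=> dk df.
pose B : {bilinear R -> W -> W} := (@GRing.scale R W).
have cB : continuous (fun p : R * W => B p.1 p.2).
  by move=> p; exact: scale_continuous.
have dB := differentiable_bilin (k x, f x) cB.
have dp := differentiable_pair dk df.
have dkf : differentiable (fun y => k y *: f y) x.
  exact: (@differentiable_comp _ _ _ _ (fun y => (k y, f y))
           (fun p : R * W => B p.1 p.2)).
split=> //; rewrite !deriveE//.
rewrite (_ : (fun y => k y *: f y) =
  (fun p : R * W => B p.1 p.2) \o (fun y => (k y, f y)))// diff_comp//=.
by rewrite diff_bilin// diff_pair.
Qed.

Lemma Ck_scale V W k (U : set V) (c : V -> R) (f : V -> W) : open U ->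
  Ck k U c -> Ck k U f -> Ck k U (fun x => c x *: f x).
Proof.
move=> oU; elim: k c f => [|k IH] c f /=.
  by move=> cc cf x Ux; apply: cvgZ; [exact: cc|exact: cf].
move=> [dc Dc] [df Df]; split=> [x Ux|v].
  by have [] := diff_scale 0 (dc x Ux) (df x Ux).
have C1 : Ck k U (fun x => c x *: 'D_v f x + 'D_v c x *: f x).
  by apply: Ck_add => //; apply: IH => //; apply: CkW.
apply: (Ck_eq oU) C1 => x Ux.
by have [_ ->] := diff_scale v (dc x Ux) (df x Ux).
Qed.

Lemma Ck_id V k (U : set V) : Ck k U (fun x : V => x).
Proof.
case: k => [|k] /=; first by move=> x _; exact: cvg_id.
split=> [x _|v]; first exact: ex_diff.
have -> : (fun x => 'D_v (fun y : V => y) x) = (fun=> v).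
  by apply/funext => x; rewrite derive_id.
exact: Ck_cst.
Qed.

Lemma Ck_linear V W k (U : set V) (l : {linear V -> W}) :
  open U -> continuous l -> Ck k U l.
Proof. by move=> oU cl; exact: (Ck_linear_post oU cl (Ck_id k U)). Qed.

Lemma Ck_pair V W Z k (U : set V) (f : V -> W) (g : V -> Z) : open U ->
  Ck k U f -> Ck k U g -> Ck k U (fun x => (f x, g x)).
Proof.
move=> oU; elim: k f g => [|k IH] f g /=.
  by move=> cf cg x Ux; apply: cvg_pair; [exact: cf|exact: cg].
move=> [df Df] [dg Dg]; split=> [x Ux|v].
  by apply: differentiable_pair; [exact: df|exact: dg].
apply: (Ck_eq oU) (IH _ _ (Df v) (Dg v)) => x Ux.
have [dfx dgx] := (df x Ux, dg x Ux).
by rewrite !deriveE ?diff_pair//; exact: differentiable_pair.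
Qed.

(** A form of finite dimension that is inherited by products; it reduces the
    derivative of a composite to finitely many fixed directions. *)
Definition coordinatized W := exists n (l : 'I_n -> {linear W -> R}) (b : 'I_n -> W),
  (forall i, continuous (l i)) /\ forall w, w = \sum_i l i w *: b i.

(** Induction on k: by the chain rule, a directional derivative of the composite is a
    sum of derivatives of g in fixed basis directions, composed with f, times
    coordinates of a derivative of f. *)
Lemma Ck_comp V W Z k (U : set V) (O : set W) (f : V -> W) (g : W -> Z) :
  coordinatized W -> open U -> open O -> (forall x, U x -> O (f x)) ->
  Ck k U f -> Ck k O g -> Ck k U (fun x => g (f x)).
Proof.
move=> [n [l [b [cl lb]]]] oU oO fO; elim: k g => [|k IH] g.
  move=> cf cg x Ux; apply: (@continuous_comp _ _ _ f g); first exact: cf.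
  exact: cg (fO _ Ux).
move=> Cf Cg; have [df Df] := Cf; have [dg Dg] := Cg.
split=> [x Ux|v].
  by apply: (@differentiable_comp _ _ _ _ f g); [exact: df|exact/dg/fO].
have CS : Ck k U (fun x => \sum_i l i ('D_v f x) *: 'D_(b i) g (f x)).
  apply: Ck_sum => // i; apply: Ck_scale => //.
    exact: (Ck_linear_post oU (cl i) (Df v)).
  exact: (IH _ (CkW Cf) (Dg (b i))).
apply: (Ck_eq oU) CS => x Ux.
have [dfx dgx] := (df x Ux, dg _ (fO x Ux)).
have dgf : differentiable (g \o f) x by exact: differentiable_comp.
rewrite [RHS]deriveE// diff_comp//= -(deriveE _ dfx).
rewrite [in RHS](lb ('D_v f x)) linear_sum.
by apply: eq_bigr => i _; rewrite linearZ/= -deriveE.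
Qed.

Lemma coordinatized_rV n : coordinatized 'rV[R]_n.
Proof.
pose c (i : 'I_n) (w : 'rV[R]_n) : R := w 0 i.
have lc i : linear (c i) by move=> a u v; rewrite /c !mxE.
pose cM i := GRing.isLinear.Build _ _ _ _ _ (lc i).
pose cL i : {linear 'rV[R]_n -> R} := HB.pack (c i) (cM i).
exists n, cL, (fun i => delta_mx 0 i); split=> [i|w].
  by move=> w; exact: coord_continuous.
exact: row_sum_delta.
Qed.

Lemma coordinatized_R : coordinatized R.
Proof.
exists 1%N, (fun=> idfun), (fun=> 1); split=> [_ w|w]; first exact: cvg_id.
by rewrite big_ord1 /= [LHS](_ : _ = w * 1)// mulr1.
Qed.

Lemma coordinatized_prod V W :
  coordinatized V -> coordinatized W -> coordinatized (V * W)%type.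
Proof.
move=> [n [l [b [cl lb]]]] [m [l' [b' [cl' lb']]]].
pose L (i : 'I_n + 'I_m) : V * W -> R :=
  match i with inl i => fun z => l i z.1 | inr j => fun z => l' j z.2 end.
have linL i : linear (L i).
  by case: i => i a u v; rewrite /L/= ?linearP.
pose LM i := GRing.isLinear.Build _ _ _ _ _ (linL i).
pose LL i : {linear (V * W)%type -> R} := HB.pack (L i) (LM i).
pose B (i : 'I_n + 'I_m) : V * W :=
  match i with inl i => (b i, 0) | inr j => (0, b' j) end.
exists (n + m)%N, (fun i : 'I_(n + m) => LL (fintype.split i)),
  (fun i : 'I_(n + m) => B (fintype.split i)); split.
  move=> i; case: (fintype.split i) => j z /=.
    by apply: (@continuous_comp _ _ _ fst (l j)); [exact: cvg_fst|exact: cl].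
  by apply: (@continuous_comp _ _ _ snd (l' j)); [exact: cvg_snd|exact: cl'].
move=> [v w]; rewrite big_split_ord/=.
under eq_bigr do rewrite (unsplitK (inl _)) /=.
under [X in _ + X]eq_bigr do rewrite (unsplitK (inr _)) /=.
rewrite {1}(lb v) {1}(lb' w).
have E1 (I : finType) (F : I -> V * W) :
    \sum_i F i = (\sum_i (F i).1, \sum_i (F i).2).
  by elim/big_rec3 : _ => // i x y z _ ->; case: (F i).
rewrite !E1 /=; congr (_, _) => /=.
  by rewrite [X in _ + X]big1 ?addr0// => i _; rewrite scaler0.
by rewrite [X in X + _]big1 ?add0r// => i _; rewrite scaler0.
Qed.

End CkCalculus.

(** * Symmetry of second derivatives *)

Section Jets.
Variable R : realType.
Implicit Types V W : normedModType R.

Lemma is_derive_line V W (f : V -> W) (x v : V) (s : R) :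
  differentiable f (x + s *: v) ->
  is_derive s (1 : R) (fun r : R => f (x + r *: v)) ('D_v f (x + s *: v)).
Proof.
move=> df; have dfv : derivable f (x + s *: v) v by exact: diff_derivable.
have E : (fun h : R => h^-1 *: (f (x + (h *: 1 + s) *: v) - f (x + s *: v)))
       = (fun h : R => h^-1 *: (f (h *: v + (x + s *: v)) - f (x + s *: v))).
  apply/funext => h; congr (_ *: (f _ - _)).
  by rewrite scalerDl addrCA (_ : h *: 1 = h)//; rewrite /GRing.scale/= mulr1.
by apply: DeriveDef; [rewrite /derivable E|rewrite /derive E].
Qed.

(** Two-sided, because the Taylor expansions are. *)
Lemma mvt_center (g dg : R -> R) (d : R) :
  (forall s, `|s| < d -> is_derive (s : R) (1 : R) g (dg s)) ->
  forall s, `|s| < d -> exists2 c, `|c| <= `|s| & g s - g 0 = dg c * s.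
Proof.
move=> dgd s sd.
have cg (a b : R) : `|a| < d -> `|b| < d -> {within `[a, b], continuous g}.
  move=> ad bd; apply: derivable_within_continuous => x.
  rewrite in_itv/= => /andP[ax xb].
  suff /dgd [] : `|x| < d by [].
  by move: ad bd; rewrite !ltr_norml; lra.
have [s0|s0|->] := ltgtP s 0; last first.
- by exists 0; rewrite // subrr mulr0.
- have d0 : `|0 : R| < d by rewrite normr0 (le_lt_trans _ sd).
  have [c|c ci gc] := @MVT R g dg 0 s s0 _ (cg _ _ d0 sd).
  + rewrite in_itv/= => /andP[c0 cs]; apply: dgd.
    by move: sd; rewrite !ltr_norml; lra.
  + exists c; last by rewrite gc subr0.
    move: ci; rewrite in_itv/= => /andP[c0 cs].
    by rewrite !gtr0_norm// ltW.
- have d0 : `|0 : R| < d by rewrite normr0 (le_lt_trans _ sd).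
  have [c|c ci gc] := @MVT R g dg s 0 s0 _ (cg _ _ sd d0).
  + rewrite in_itv/= => /andP[c0 cs]; apply: dgd.
    by move: sd; rewrite !ltr_norml; lra.
  + exists c; last by rewrite -opprB gc sub0r mulrN opprK.
    move: ci; rewrite in_itv/= => /andP[c0 cs].
    by rewrite !ltr0_norm// lerN2 ltW.
Qed.

Lemma diff_remainder V (f : V -> R) x (e : R) : differentiable f x -> 0 < e ->
  exists2 d, 0 < d & forall h, `|h| < d ->
    `|f (x + h) - f x - 'D_h f x| <= e * `|h|.
Proof.
move=> df e0; have := diff_locally df.
move=> /eqaddoP /(_ e e0) /nbhs_norm0P[d /= d0 H].
exists d => // h hd; have /= := H h hd.
by rewrite !fctE /= deriveE// [h + x]addrC opprD addrA.
Qed.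

(** For fixed h the second difference is the increment over [0, h] of
    s |-> f (x + h w + s v) - f (x + s v).  The mean value theorem turns it into h times
    a difference of values of the derivative along v, and the differentiability of
    that derivative at x gives the limit. *)
Lemma second_difference V (f : V -> R) (U : set V) x v w : open U -> U x ->
  Ck 2 U f -> forall e, 0 < e -> \forall h \near (0 : R)^'+,
  `|f (x + h *: v + h *: w) - f (x + h *: v) - f (x + h *: w) + f x
    - h ^+ 2 * 'D_w (fun y => 'D_v f y) x| <= e * h ^+ 2.
Proof.
move=> oU Ux Cf e e0; have [df Df] := Cf.
have dDv : differentiable (fun y => 'D_v f y) x by have [+ _] := Df v; exact.
pose p := (fun y => 'D_v f y).
pose N := `|v| + `|w| + 1.
have N0 : 0 < N by rewrite /N ltr_wpDl// addr_ge0.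
have e2N : 0 < e / (2 * N) by rewrite divr_gt0// mulr_gt0.
have [d d0 Hd] := diff_remainder dDv e2N.
have /nbhs_ballP[d' /= d'0 Hd'] := open_nbhs_nbhs (conj oU Ux).
have inU k : `|k| < d' -> U (x + k).
  move=> kd; apply: Hd'; rewrite -ball_normE/= opprD addrA subrr add0r.
  by rewrite normrN.
near=> h.
have h0 : 0 < h by near: h; exact: nbhs_right_gt.
have hd : h * N < Num.min d d'.
  rewrite -ltr_pdivlMr//; near: h; apply: nbhs_right_lt.
  by rewrite divr_gt0// lt_min d0.
have small k : 0 <= k <= h -> `|k *: v + h *: w| < Num.min d d' /\
     `|k *: v| < Num.min d d' /\
     `|k *: v + h *: w| <= h * N /\ `|k *: v| <= h * N.
  move=> /andP[k0 kh].
  have k1 : `|k *: v| <= h * `|v|.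
    by rewrite normrZ ger0_norm// ler_wpM2r.
  have k2 : `|k *: v + h *: w| <= h * N.
    apply: (le_trans (ler_normD _ _)); rewrite [`|h *: w|]normrZ (gtr0_norm h0).
    by rewrite /N !mulrDr mulr1; have := ltW h0; lra.
  have k3 : `|k *: v| <= h * N.
    apply: (le_trans k1); rewrite ler_pM2l// /N.
    by have := normr_ge0 w; lra.
  by do !split => //; apply: le_lt_trans hd.
pose g (s : R) := f (x + h *: w + s *: v) - f (x + s *: v).
pose dg (s : R) := p (x + h *: w + s *: v) - p (x + s *: v).
have gd s : 0 <= s <= h -> is_derive (s : R) (1 : R) g (dg s).
  move=> sh; have [s1 [s2 _]] := small s sh.
  move: s1 s2; rewrite !lt_min => /andP[_ s1] /andP[_ s2].
  have dA : differentiable f (x + h *: w + s *: v).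
    by apply: df; rewrite -addrA; apply: inU; rewrite addrC.
  have dB : differentiable f (x + s *: v) by apply: df; exact: inU.
  have := is_derive_line dA; have := is_derive_line dB => ? ?.
  exact: is_deriveB.
have cg : {within `[0, h], continuous g}.
  apply: derivable_within_continuous => s; rewrite in_itv/= => sh.
  by have [] := gd s sh.
have [s|s] := @MVT R g dg 0 h h0 _ cg.
  by rewrite in_itv/= => /andP[s0 sh]; apply: gd; rewrite !ltW.
rewrite in_itv/= => /andP[/ltW s0 /ltW sh]; rewrite subr0 => E.
have -> : f (x + h *: v + h *: w) - f (x + h *: v) - f (x + h *: w) + f x
    = dg s * h.
  rewrite -E /g !scale0r !addr0 [x + h *: v + _]addrAC; ring.
have EN : e / (2 * N) * (h * N) = e / 2 * h.
  have : N != 0 by rewrite gt_eqF.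
  by move: (N) => n n0; field.
have s0h : 0 <= s <= h by rewrite s0.
have [s1 [s2 [s3 s4]]] := small s s0h.
have := Hd (s *: v + h *: w); have := Hd (s *: v).
move: s1 s2; rewrite !lt_min => /andP[s1 _] /andP[s2 _].
move=> /(_ s2) H1 /(_ s1) H2.
have L : 'D_(s *: v + h *: w) p x = 'D_(s *: v) p x + h * 'D_w p x.
  by rewrite !deriveE// linearD !linearZ.
have -> : dg s * h - h ^+ 2 * 'D_w p x =
   h * ((p (x + (s *: v + h *: w)) - p x - 'D_(s *: v + h *: w) p x)
      - (p (x + s *: v) - p x - 'D_(s *: v) p x)).
  rewrite L /dg [s *: v + h *: w]addrC addrA.
  move: (p _) (p (x + s *: v)) (p x) ('D_(s *: v) p x) ('D_w p x) => a b c k l.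
  ring.
rewrite normrM (gtr0_norm h0).
have H3 : `|p (x + (s *: v + h *: w)) - p x - 'D_(s *: v + h *: w) p x| <=
    e / 2 * h.
  apply: (le_trans H2); apply: (@le_trans _ _ (e / (2 * N) * (h * N))).
    by rewrite ler_pM2l.
  by rewrite EN.
have H4 : `|p (x + s *: v) - p x - 'D_(s *: v) p x| <= e / 2 * h.
  apply: (le_trans H1); apply: (@le_trans _ _ (e / (2 * N) * (h * N))).
    by rewrite ler_pM2l.
  by rewrite EN.
rewrite (_ : e * h ^+ 2 = h * (e / 2 * h + e / 2 * h)); last by field.
rewrite ler_pM2l; last exact: h0.
apply: le_trans (ler_normB _ _) _; exact: lerD H3 H4.
Unshelve. all: by end_near. Qed.

Lemma same_limit (A p q h e : R) : 0 < h -> `|A - h * p| <= e / 2 * h ->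
  `|A - h * q| <= e / 2 * h -> `|p - q| <= e.
Proof.
move=> h0 H1 H2; rewrite -(ler_pM2l h0) -{1}(gtr0_norm h0) -normrM.
by move: H1 H2; rewrite !ler_norml; lra.
Qed.

(** The second difference is symmetric in v and w. *)
Theorem derive_comm V (f : V -> R) (U : set V) x v w : open U -> U x ->
  Ck 2 U f -> 'D_w (fun y => 'D_v f y) x = 'D_v (fun y => 'D_w f y) x.
Proof.
move=> oU Ux Cf; apply/eqP; rewrite -subr_eq0 -normr_le0.
apply/ler_addgt0Pl => e e0; rewrite addr0.
have e2 : 0 < e / 2 by rewrite divr_gt0.
have A := second_difference v w oU Ux Cf e2.
have B := second_difference w v oU Ux Cf e2.
have [h [HA [HB h0]]] := filter_ex (filterI A (filterI B (nbhs_right_gt (0 : R)))).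
apply: (same_limit (exprn_gt0 2 h0) HA).
move: HB; rewrite [x + h *: w + h *: v]addrAC.
by rewrite [f _ - _ - f (x + h *: v)]addrAC.
Qed.

End Jets.

(** * Second-order Taylor expansions on the real line *)

Section PeanoJets.
Variable R : realType.
Implicit Types (f g : R -> R) (c d : R * R * R).

(** The remainder is s^2 times a function that is continuous at 0, with the second
    coefficient as its value there.  Requiring the identity for all s costs nothing,
    since rho is arbitrary away from 0, and keeps the algebra free of neighbourhoods. *)
Definition jet f c := exists rho : R -> R,
  [/\ rho @ (0 : R) --> rho 0, rho 0 = c.2 &
      forall s, f s = c.1.1 + c.1.2 * s + s ^+ 2 * rho s].

(** Arithmetic of truncated power series; the second coefficient is half of the second
    derivative. *)
Definition jadd c d : R * R * R := (c.1.1 + d.1.1, c.1.2 + d.1.2, c.2 + d.2).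
Definition jopp c : R * R * R := (- c.1.1, - c.1.2, - c.2).
Definition jmul c d : R * R * R :=
  (c.1.1 * d.1.1, c.1.1 * d.1.2 + c.1.2 * d.1.1,
   c.1.1 * d.2 + c.1.2 * d.1.2 + c.2 * d.1.1).
Definition jinv c : R * R * R :=
  (c.1.1^-1, - c.1.2 / c.1.1 ^+ 2, (c.1.2 ^+ 2 - c.2 * c.1.1) / c.1.1 ^+ 3).

Lemma jet_cst k : jet (fun=> k) (k, 0, 0).
Proof.
exists (fun=> 0); split => [|//|s /=]; first exact: cvg_cst.
by rewrite mul0r mulr0 !addr0.
Qed.

Lemma jetD f g c d : jet f c -> jet g d -> jet (fun s => f s + g s) (jadd c d).
Proof.
move=> [p [cp p0 fp]] [q [cq q0 gq]]; exists (fun s => p s + q s); split=> /=.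
- exact: cvgD.
- by rewrite p0 q0.
- by move=> s; rewrite fp gq; ring.
Qed.

Lemma jetN f c : jet f c -> jet (fun s => - f s) (jopp c).
Proof.
move=> [p [cp p0 fp]]; exists (fun s => - p s); split=> /=.
- exact: cvgN.
- by rewrite p0.
- by move=> s; rewrite fp; ring.
Qed.

Lemma jetM f g c d : jet f c -> jet g d -> jet (fun s => f s * g s) (jmul c d).
Proof.
move=> [p [cp p0 fp]] [q [cq q0 gq]].
exists (fun s => c.1.1 * q s + p s * d.1.1 + c.1.2 * d.1.2 +
  s * (c.1.2 * q s + p s * d.1.2 + s * (p s * q s))); split=> /=.
- apply: cvgD; first apply: cvgD; first apply: cvgD.
  + by apply: cvgM => //; exact: cvg_cst.
  + by apply: cvgM => //; exact: cvg_cst.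
  + exact: cvg_cst.
  + apply: cvgM; first exact: cvg_id.
    apply: cvgD; first apply: cvgD.
    * by apply: cvgM => //; exact: cvg_cst.
    * by apply: cvgM => //; exact: cvg_cst.
    * by apply: cvgM; [exact: cvg_id|exact: cvgM].
- by rewrite p0 q0; ring.
- by move=> s; rewrite fp gq; ring.
Qed.

Lemma jet_at0 f c : jet f c -> f 0 = c.1.1.
Proof. by move=> [p [_ _ ->]]; ring. Qed.

Lemma jet_near f g c : (\forall s \near (0 : R), f s = g s) -> jet f c -> jet g c.
Proof.
move=> fg [p [cp p0 fp]]; have f0g0 := nbhs_singleton fg.
exists (fun s => if s == 0 then c.2 else (g s - c.1.1 - c.1.2 * s) / s ^+ 2).
rewrite eqxx; split=> //= [|s].
  rewrite -p0; apply: cvg_trans cp; apply: near_eq_cvg.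
  near=> s; case: eqVneq => [->//|s0].
  by rewrite -(near fg s)// fp; field.
case: eqVneq => [->|s0]; last by field.
by rewrite -f0g0 fp; ring.
Unshelve. all: by end_near. Qed.

Lemma jet_cvg f c : jet f c -> f @ (0 : R) --> f 0.
Proof.
move=> [p [cp p0 fp]]; rewrite (_ : f = fun s => c.1.1 + c.1.2 * s + s ^+ 2 * p s).
  apply: cvgD; first apply: cvgD.
  + exact: cvg_cst.
  + by apply: cvgM; [exact: cvg_cst|exact: cvg_id].
  + by apply: cvgM => //; exact: exprn_continuous.
exact/funext.
Qed.

Lemma jetV f c : c.1.1 != 0 -> jet f c -> jet (fun s => (f s)^-1) (jinv c).
Proof.
move=> c0 jf; have cf := jet_cvg jf; have f0 := jet_at0 jf.
have [p [cp p0 fp]] := jf.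
pose q (s : R) := - (- c.1.2 / c.1.1 ^+ 2 * c.1.2 + c.1.1^-1 * p s
   + s * (- c.1.2 / c.1.1 ^+ 2 * p s)) / f s.
have nf : \forall s \near (0 : R), f s != 0.
  by apply: (cf [set y | y != 0]); apply: open_nbhs_nbhs; split;
    [exact: open_neq|rewrite /= f0].
apply: (@jet_near (fun s => c.1.1^-1 + - c.1.2 / c.1.1 ^+ 2 * s + s ^+ 2 * q s)).
  near=> s; have fs0 : f s != 0 by near: s.
  rewrite /q; apply: (mulIf fs0); rewrite mulVf// mulrDl.
  by rewrite -[s ^+ 2 * _ * _]mulrA divfK// [in LHS]fp; field.
exists q; split=> //=; last by rewrite /q f0 p0; field.
rewrite {2}/q; apply: cvgM; last by apply: cvgV; rewrite ?f0// -?f0.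
apply: cvgN; apply: cvgD; first apply: cvgD.
- exact: cvg_cst.
- by apply: cvgM => //; exact: cvg_cst.
- by apply: cvgM; [exact: cvg_id|apply: cvgM => //; exact: cvg_cst].
Unshelve. all: by end_near. Qed.

Lemma cvg0_zero f : f @ (0 : R) --> f 0 -> (forall s, s != 0 -> f s = 0) ->
  f 0 = 0.
Proof.
move=> cf fz; have c1 : f @ (0 : R)^' --> f 0.
  by apply: cvg_trans cf; apply: cvg_app; exact: nbhs_dnbhs.
have c2 : f @ (0 : R)^' --> (0 : R).
  apply: (@cvg_trans _ ((fun=> 0 : R) @ (0 : R)^')); last exact: cvg_cst.
  apply: near_eq_cvg; near=> s.
  by rewrite fz//; near: s; exact: nbhs_dnbhs_neq.
exact: (cvg_unique _ c1 c2).
Unshelve. all: by end_near. Qed.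

Lemma jet_uniq f c d : jet f c -> jet f d -> c = d.
Proof.
move=> jc jd; have := jet_at0 jc; rewrite (jet_at0 jd) => e0.
move: jc jd => [p [cp p0 fp]] [q [cq q0 gq]].
have e1 : c.1.2 = d.1.2.
  have := @cvg0_zero (fun s => c.1.2 - d.1.2 + s * (p s - q s)).
  rewrite mul0r addr0 => H; apply/eqP; rewrite -subr_eq0; apply/eqP/H => [|s s0].
    have : c.1.2 - d.1.2 + s * (p s - q s) @[s --> (0 : R)] -->
        c.1.2 - d.1.2 + 0 * (p 0 - q 0).
      apply: cvgD; first exact: cvg_cst.
      by apply: cvgM; [exact: cvg_id|exact: cvgB].
    by rewrite mul0r addr0.
  suff : s * (c.1.2 - d.1.2 + s * (p s - q s)) = 0.
    by move/eqP; rewrite mulf_eq0 (negPf s0) => /eqP.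
  by have := fp s; rewrite gq e0; lra.
have e2 : c.2 = d.2.
  have := @cvg0_zero (fun s => p s - q s).
  rewrite p0 q0 => H; apply/eqP; rewrite -subr_eq0; apply/eqP/H => [|s s0].
    by rewrite -p0 -q0; exact: cvgB.
  have s2 : s ^+ 2 != 0 by rewrite expf_neq0.
  suff : s ^+ 2 * (p s - q s) = 0.
    by move/eqP; rewrite mulf_eq0 (negPf s2) => /eqP.
  by have := fp s; rewrite gq e0 e1; lra.
by case: c d e0 e1 e2 {fp gq p0 q0} => [[? ?] ?] [[? ?] ?] /= -> -> ->.
Qed.

Lemma nbhs_left_nbhs (P : set R) (x : R) : nbhs x P -> (nbhs x^'-) P.
Proof. by move=> xP; rewrite /at_left; apply: filterS xP => y Py _. Qed.

Lemma nbhs_right_nbhs (P : set R) (x : R) : nbhs x P -> (nbhs x^'+) P.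
Proof. by move=> xP; rewrite /at_right; apply: filterS xP => y Py _. Qed.

Lemma jet_slope_cvg f c : jet f c ->
  exists2 g : R -> R, g @ (0 : R) --> c.1.2 & forall s, f s - f 0 = s * g s.
Proof.
move=> jf; have f0 := jet_at0 jf; have [p [cp p0 fp]] := jf.
exists (fun s => c.1.2 + s * p s).
  have : c.1.2 + s * p s @[s --> (0 : R)] --> c.1.2 + 0 * p 0.
    apply: cvgD; first exact: cvg_cst.
    by apply: cvgM => //; exact: cvg_id.
  by rewrite mul0r addr0.
by move=> s; rewrite f0 fp; ring.
Qed.

(** Meant for the time variable, where only earlier times can be compared. *)
Lemma jet_left_max f c : jet f c -> (\forall s \near (0 : R)^'-, f s <= f 0) ->
  0 <= c.1.2.
Proof.
move=> jf fm; have [g cg fg] := jet_slope_cvg jf.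
rewrite leNgt; apply/negP => c0.
have gn : \forall s \near (0 : R)^'-, g s < 0.
  apply: nbhs_left_nbhs; apply: (cg [set y | y < 0]).
  by apply: open_nbhs_nbhs; split; [exact: open_lt|].
have [s [s0 [fs gs]]] := filter_ex (filterI (nbhs_left_lt (0 : R)) (filterI fm gn)).
have := fg s; have : 0 < s * g s by rewrite nmulr_rgt0.
by move: fs; lra.
Qed.

Lemma jet_max f c : jet f c -> (\forall s \near (0 : R), f s <= f 0) ->
  c.1.2 = 0 /\ c.2 <= 0.
Proof.
move=> jf fm; have [g cg fg] := jet_slope_cvg jf.
have c0 : 0 <= c.1.2.
  by apply: (jet_left_max jf); exact: nbhs_left_nbhs.
have c1 : c.1.2 = 0.
  apply/le_anti; rewrite c0 andbT leNgt; apply/negP => c1.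
  have gp : \forall s \near (0 : R)^'+, 0 < g s.
    apply: nbhs_right_nbhs; apply: (cg [set y | 0 < y]).
    by apply: open_nbhs_nbhs; split; [exact: open_gt|].
  have [s [s0 [fs gs]]] := filter_ex (filterI (nbhs_right_gt (0 : R))
    (filterI (nbhs_right_nbhs fm) gp)).
  have := fg s; have : 0 < s * g s by rewrite mulr_gt0.
  by move: fs; lra.
split=> //; rewrite leNgt; apply/negP => c2.
have f0 := jet_at0 jf; have [p [cp p0 fp]] := jf.
have pp : \forall s \near (0 : R)^'+, 0 < p s.
  apply: nbhs_right_nbhs; apply: (cp [set y | 0 < y]).
  by apply: open_nbhs_nbhs; split; [exact: open_gt|rewrite /= p0].
have [s [s0 [fs ps]]] := filter_ex (filterI (nbhs_right_gt (0 : R))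
  (filterI (nbhs_right_nbhs fm) pp)).
have : 0 < s ^+ 2 * p s by rewrite mulr_gt0// exprn_gt0.
by move: fs; rewrite f0 fp c1 mul0r; lra.
Qed.

Lemma taylor_quotient (F D k f0 s : R) : s != 0 ->
  k - (F - f0 - D * s) / s ^+ 2 =
    - ((F - D * s - k * s ^+ 2 - (f0 - D * 0 - k * 0 ^+ 2)) / s / s).
Proof. by move=> s0; field. Qed.

(** Taylor's formula with Peano remainder: the remainder divided by s^2 is a difference
    quotient, evaluated at a mean value point, of the derivative along v minus its
    limit. *)
Theorem Ck_jet (V : normedModType R) (U : set V) (f : V -> R) x v :
  open U -> U x -> Ck 2 U f ->
  jet (fun s => f (x + s *: v)) (f x, 'D_v f x, 'D_v (fun y => 'D_v f y) x / 2).
Proof.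
move=> oU Ux [df Df].
have dDv : differentiable (fun y => 'D_v f y) x by have [+ _] := Df v; exact.
pose p := (fun y => 'D_v f y).
pose q s := (f (x + s *: v) - f x - 'D_v f x * s) / s ^+ 2.
pose c2 := 'D_v p x / 2.
have /nbhs_ballP[d' /= d'0 Hd'] := open_nbhs_nbhs (conj oU Ux).
have inU k : `|k| < d' -> U (x + k).
  move=> kd; apply: Hd'; rewrite -ball_normE/= opprD addrA subrr add0r.
  by rewrite normrN.
pose N := `|v| + 1.
have N0 : 0 < N by rewrite /N ltr_wpDl.
exists (fun s => if s == 0 then c2 else q s); rewrite eqxx; split=> // [|s /=].
  apply/cvgrPdist_le => e e0.
  have eN : 0 < e / N by rewrite divr_gt0.
  have [d d0 Hd] := diff_remainder dDv eN.
  pose m := Num.min d d' / N.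
  have m0 : 0 < m by rewrite divr_gt0// lt_min d0.
  have nm : \forall s \near (0 : R), `|s| < m by exact: nbhs0_lt.
  near=> s; case: eqVneq => [_|s0]; first by rewrite subrr normr0 ltW.
  have sm : `|s| < m by near: s; exact: nm.
  have small r : `|r| < m -> `|r *: v| < Num.min d d'.
    rewrite ltr_pdivlMr// normrZ; apply: le_lt_trans.
    by rewrite ler_wpM2l// /N lerDl.
  pose g r := f (x + r *: v) - 'D_v f x * r - c2 * r ^+ 2.
  pose dg r := p (x + r *: v) - 'D_v f x - c2 * (r *+ 2).
  have gd r : `|r| < m -> is_derive (r : R) (1 : R) g (dg r).
    move=> /small; rewrite lt_min => /andP[_ /inU /df /is_derive_line D1].
    have D2 : is_derive (r : R) (1 : R) (fun r : R => 'D_v f x * r) ('D_v f x).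
      by apply: is_derive_eq; rewrite /GRing.scale/= mulr1.
    have D3 : is_derive (r : R) (1 : R) (fun r : R => c2 * r ^+ 2) (c2 * (r *+ 2)).
      by apply: is_derive_eq; rewrite /GRing.scale/= mulr2n !mulr1.
    exact: (@is_deriveB _ _ _ _ _ _ _ _ _ (@is_deriveB _ _ _ _ _ _ _ _ _ D1 D2) D3).
  have [c cs E] := mvt_center gd sm.
  have cm : `|c| < m := le_lt_trans cs sm.
  have := small c cm; rewrite lt_min => /andP[cd _].
  have := Hd _ cd; rewrite [in 'D_(c *: v) _ _]deriveE// linearZ/= -deriveE//.
  rewrite normrZ => H.
  have Eq : c2 - q s = - (dg c / s).
    have -> : dg c = (g s - g 0) / s by rewrite E mulfK.
    rewrite /q /g scale0r addr0; exact: taylor_quotient.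
  rewrite Eq normrN normrM normfV ler_pdivrMr ?normr_gt0//.
  have -> : dg c = p (x + c *: v) - p x - c * 'D_v p x.
    have gen (A B D k : R) : A - B - D / 2 * (k *+ 2) = A - B - k * D.
      by rewrite mulr2n; field.
    exact: gen.
  apply: (le_trans H); apply: (@le_trans _ _ (e / N * (`|s| * N))).
    by rewrite ler_pM2l// ler_pM// /N lerDl.
  by rewrite [`|s| * N]mulrC mulrA divfK ?gt_eqF.
case: eqVneq => [->|s0]; first by rewrite scale0r addr0; ring.
by rewrite /q; field.
Unshelve. all: by end_near. Qed.

End PeanoJets.

(** * The inequality between curvatures at a maximum *)

(* Syntactic matching keeps unification from unfolding the powers. *)
Ltac nonneg := repeat match goal with
  | |- is_true (0 <= _ + _) => apply: addr_ge0
  | |- is_true (0 <= (_ - _) ^+ 2) => exact: sqr_ge0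
  | |- is_true (0 <= _ / _) => apply: divr_ge0
  | |- is_true (0 <= _ * _) => apply: mulr_ge0
  | |- is_true (0 <= _ ^+ _) => apply: exprn_ge0
  | |- is_true (0 <= _%:R) => exact: ler0n
  | |- _ => first [assumption | exact: ltW]
  end.

Section Inequality.
Variable R : realFieldType.
Implicit Types a b c t : R.

(** Up to positive factors, the partial derivatives of the pinching quantity are
    (a - b) alpha a b and - (a - b) alpha b a. *)
Definition alpha a b := 4 * a ^+ 6 + 9 * a ^+ 5 * b + 11 * a ^+ 4 * b ^+ 2
  + 10 * a ^+ 3 * b ^+ 3 + 2 * a ^+ 2 * b ^+ 4 + 3 * a * b ^+ 5 + b ^+ 6.

(** Up to a negative factor, the coefficient of the square of the free parameter among
    the third order terms once the gradient of the pinching quantity is zero.  Large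
    coefficients are split, because numerals stand for unary natural numbers. *)
Definition gradient_form a b :=
    11 * a ^+ 22 + 90 * a ^+ 21 * b - 113 * a ^+ 20 * b ^+ 2
    - 840 * a ^+ 19 * b ^+ 3 - (10 ^+ 3 + 507) * a ^+ 18 * b ^+ 4
    + 66 * a ^+ 17 * b ^+ 5 + (7 * 10 ^+ 3 + 465) * a ^+ 16 * b ^+ 6
    + (23 * 10 ^+ 3 + 136) * a ^+ 15 * b ^+ 7
    + (45 * 10 ^+ 3 + 494) * a ^+ 14 * b ^+ 8
    + (70 * 10 ^+ 3 + 100) * a ^+ 13 * b ^+ 9
    + (84 * 10 ^+ 3 + 982) * a ^+ 12 * b ^+ 10
    + (85 * 10 ^+ 3 + 120) * a ^+ 11 * b ^+ 11
    + (70 * 10 ^+ 3 + 882) * a ^+ 10 * b ^+ 12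
    + (52 * 10 ^+ 3 + 148) * a ^+ 9 * b ^+ 13
    + (33 * 10 ^+ 3 + 938) * a ^+ 8 * b ^+ 14
    + (20 * 10 ^+ 3 + 928) * a ^+ 7 * b ^+ 15
    + (11 * 10 ^+ 3 + 263) * a ^+ 6 * b ^+ 16
    + (5 * 10 ^+ 3 + 490) * a ^+ 5 * b ^+ 17
    + (2 * 10 ^+ 3 + 363) * a ^+ 4 * b ^+ 18 + 744 * a ^+ 3 * b ^+ 19
    + 193 * a ^+ 2 * b ^+ 20 + 42 * a * b ^+ 21 + 5 * b ^+ 22.

Lemma alpha_gt0 a b : 0 < a -> 0 < b -> 0 < alpha a b.
Proof. by move=> a0 b0; rewrite /alpha !addr_gt0 ?mulr_gt0 ?exprn_gt0. Qed.

(** The negative terms come closest to the positive ones near a = 3 b; taking away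
    suitable multiples of (a - 3 b)^2 leaves only nonnegative coefficients. *)
Lemma gradient_form_ge0 a b : 0 < a -> 0 < b -> 0 <= gradient_form a b.
Proof.
move=> a0 b0.
have -> : gradient_form a b = (
    11 * a ^+ 20 + 156 * a ^+ 19 * b + 724 * a ^+ 18 * b ^+ 2
    + (2 * 10 ^+ 3 + 100) * a ^+ 17 * b ^+ 3
    + (4 * 10 ^+ 3 + 100) * a ^+ 16 * b ^+ 4
    + (5 * 10 ^+ 3 + 750) * a ^+ 15 * b ^+ 5
    + (4 * 10 ^+ 3 + 875) * a ^+ 14 * b ^+ 6)
    * (a - 3 * b) ^+ 2 + (
    477 * a ^+ 18 * b ^+ 4 + 16 * a ^+ 17 * b ^+ 5 + 190 * a ^+ 16 * b ^+ 6
    + 636 * a ^+ 15 * b ^+ 7 + (10 ^+ 3 + 619) * a ^+ 14 * b ^+ 8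
    + (70 * 10 ^+ 3 + 100) * a ^+ 13 * b ^+ 9
    + (84 * 10 ^+ 3 + 982) * a ^+ 12 * b ^+ 10
    + (85 * 10 ^+ 3 + 120) * a ^+ 11 * b ^+ 11
    + (70 * 10 ^+ 3 + 882) * a ^+ 10 * b ^+ 12
    + (52 * 10 ^+ 3 + 148) * a ^+ 9 * b ^+ 13
    + (33 * 10 ^+ 3 + 938) * a ^+ 8 * b ^+ 14
    + (20 * 10 ^+ 3 + 928) * a ^+ 7 * b ^+ 15
    + (11 * 10 ^+ 3 + 263) * a ^+ 6 * b ^+ 16
    + (5 * 10 ^+ 3 + 490) * a ^+ 5 * b ^+ 17
    + (2 * 10 ^+ 3 + 363) * a ^+ 4 * b ^+ 18 + 744 * a ^+ 3 * b ^+ 19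
    + 193 * a ^+ 2 * b ^+ 20 + 42 * a * b ^+ 21 + 5 * b ^+ 22).
  by rewrite /gradient_form; ring.
by nonneg.
Qed.

(** The maximum principle computation.  Here w is the value of the pinching quantity,
    c0, c1, c2, c3 are h_11;1, h_11;2, h_22;1, h_22;2, and p1, r1, p2, r2 are h_11;11,
    h_22;11, h_11;22, h_22;22; thus h1, k1, H11, K11 are derivatives of H and K.  In
    order to avoid quotients, w is differentiated implicitly: uh, uk, uhh, uhk, ukk
    are the partial derivatives of pn - w h k with w held fixed. *)
Lemma pinching_inequality a b c0 c1 c2 c3 p1 r1 p2 r2 w :
  0 < a -> 0 < b -> a != b ->
  let h := a + b in let k := a * b in
  let pn := (h ^+ 4 - 2 * h ^+ 2 * k + 2 * k ^+ 2) * (h ^+ 2 - 4 * k) in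
  w * (h * k) = pn ->
  let h1 := c0 + c2 in let h2 := c1 + c3 in
  let k1 := b * c0 + a * c2 in let k2 := b * c1 + a * c3 in
  let H11 := p1 + r1 in let H22 := p2 + r2 in
  let K11 := b * p1 + a * r1 + 2 * (c0 * c2 - c1 ^+ 2) in
  let K22 := b * p2 + a * r2 + 2 * (c1 * c3 - c2 ^+ 2) in
  let uh := 6 * h ^+ 5 - 24 * h ^+ 3 * k + 20 * h * k ^+ 2 - w * k in
  let uk := - 6 * h ^+ 4 + 20 * h ^+ 2 * k - 24 * k ^+ 2 - w * h in
  let uhh := 30 * h ^+ 4 - 72 * h ^+ 2 * k + 20 * k ^+ 2 in
  let uhk := - 24 * h ^+ 3 + 40 * h * k - w in
  let ukk := 20 * h ^+ 2 - 48 * k in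
  let s := h ^+ 2 - 2 * k in
  let s1 := 2 * h * h1 - 2 * k1 in let s2 := 2 * h * h2 - 2 * k2 in
  let F11 := 2 * s * (2 * h * H11 + 2 * h1 ^+ 2 - 2 * K11) + 2 * s1 ^+ 2 in
  let F22 := 2 * s * (2 * h * H22 + 2 * h2 ^+ 2 - 2 * K22) + 2 * s2 ^+ 2 in
  p2 = r1 + a * b * (a - b) ->
  uh * h1 + uk * k1 = 0 -> uh * h2 + uk * k2 = 0 ->
  uh * H11 + uk * K11 + uhh * h1 ^+ 2 + 2 * uhk * h1 * k1 + ukk * k1 ^+ 2 <= 0 ->
  uh * H22 + uk * K22 + uhh * h2 ^+ 2 + 2 * uhk * h2 * k2 + ukk * k2 ^+ 2 <= 0 ->
  uh * (F11 + F22 + s ^+ 2 * (a ^+ 2 + b ^+ 2))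
    + uk * (b * F11 + a * F22 + s ^+ 2 * (a + b) * (a * b)) <= 0.
Proof.
move=> a0 b0 ab h k pn Ew h1 h2 k1 k2 H11 H22 K11 K22 uh uk uhh uhk ukk s s1 s2
  F11 F22 Ep crit1 crit2 hess1 hess2.
have h0 : 0 < h by rewrite addr_gt0.
have [an bn hn] : [/\ a != 0, b != 0 & a + b != 0] by rewrite !gt_eqF.
have abn : a - b != 0 by rewrite subr_eq0.
have {}Ew : w = pn / (h * k).
  by rewrite -Ew mulfK// mulf_neq0// mulf_neq0.
have al := alpha_gt0 a0 b0; have be := alpha_gt0 b0 a0.
have aln : alpha a b != 0 by rewrite gt_eqF.
have ben : alpha b a != 0 by rewrite gt_eqF.
have c2E : c2 = b * alpha a b * (c0 / (a * alpha b a)).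
  have : (a - b) * (b * alpha a b * c0 - a * alpha b a * c2) = 0.
    rewrite -[RHS](mulr0 (a * b * (a + b))) -crit1 /uh /uk /h1 /k1 Ew /pn /h /k /alpha.
    by field; rewrite an bn hn.
  move/eqP; rewrite mulf_eq0 (negPf abn)/= => /eqP E.
  have {}E : b * alpha a b * c0 = a * alpha b a * c2 by apply/eqP; rewrite -subr_eq0 E.
  by rewrite mulrA E mulrC mulKf// mulf_neq0.
have c1E : c1 = a * alpha b a * (c3 / (b * alpha a b)).
  have : (a - b) * (b * alpha a b * c1 - a * alpha b a * c3) = 0.
    rewrite -[RHS](mulr0 (a * b * (a + b))) -crit2 /uh /uk /h2 /k2 Ew /pn /h /k /alpha.
    by field; rewrite an bn hn.
  move/eqP; rewrite mulf_eq0 (negPf abn)/= => /eqP E.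
  have {}E : b * alpha a b * c1 = a * alpha b a * c3 by apply/eqP; rewrite -subr_eq0 E.
  by rewrite mulrA -E mulrC mulKf// mulf_neq0.
(* The vanishing gradient leaves one free parameter in each of the pairs (c0, c2)
   and (c3, c1). *)
pose t := c0 / (a * alpha b a); pose q := c3 / (b * alpha a b).
have c0E : c0 = a * alpha b a * t by rewrite /t mulrC divfK// mulf_neq0.
have c3E : c3 = b * alpha a b * q by rewrite /q mulrC divfK// mulf_neq0.
rewrite -/t in c2E; rewrite -/q in c1E; clearbody t q.
(* The zero order term and the left-hand sides of hess1 and hess2. *)
pose Z := 12 * a ^+ 3 * b ^+ 3 * (a - b) ^+ 2 / (a + b) *
  (3 * a ^+ 4 + 4 * a ^+ 3 * b + 6 * a ^+ 2 * b ^+ 2 + 4 * a * b ^+ 3 + 3 * b ^+ 4).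
pose E1 := uh * H11 + uk * K11 + uhh * h1 ^+ 2 + 2 * uhk * h1 * k1 + ukk * k1 ^+ 2.
pose E2 := uh * H22 + uk * K22 + uhh * h2 ^+ 2 + 2 * uhk * h2 * k2 + ukk * k2 ^+ 2.
have -> : uh * (F11 + F22 + s ^+ 2 * (a ^+ 2 + b ^+ 2))
    + uk * (b * F11 + a * F22 + s ^+ 2 * (a + b) * (a * b)) =
  4 * s * (a * E1 + b * E2) - Z
  - 4 * b / (a * (a + b)) * gradient_form a b * t ^+ 2
  - 4 * a / (b * (a + b)) * gradient_form b a * q ^+ 2.
  rewrite /E1 /E2 /Z /F11 /F22 /K11 /K22 /H11 /H22 /uhh /uhk /ukk /uh /uk Ew /pn.
  rewrite /s1 /s2 /s /h1 /h2 /k1 /k2 /k /h Ep c2E c1E c0E c3E /alpha /gradient_form.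
  by field; rewrite an bn hn.
have s0 : 0 <= s.
  rewrite (_ : s = a ^+ 2 + b ^+ 2); first by rewrite addr_ge0 ?sqr_ge0.
  by rewrite /s /h /k; ring.
have T1 : 4 * s * (a * E1 + b * E2) <= 0.
  rewrite mulr_ge0_le0 ?mulr_ge0 ?ler0n// -[leRHS]addr0.
  by rewrite lerD// mulr_ge0_le0// ltW.
have T2 : 0 <= Z.
  by rewrite /Z; nonneg.
have T3 : 0 <= 4 * b / (a * (a + b)) * gradient_form a b * t ^+ 2.
  rewrite mulr_ge0 ?sqr_ge0// mulr_ge0 ?gradient_form_ge0//.
  by rewrite divr_ge0 ?mulr_ge0 ?ltW.
have T4 : 0 <= 4 * a / (b * (a + b)) * gradient_form b a * q ^+ 2.
  rewrite mulr_ge0 ?sqr_ge0// mulr_ge0 ?gradient_form_ge0//.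
  by rewrite divr_ge0 ?mulr_ge0 ?ltW.
move: (4 * s * _) (Z) (_ * t ^+ 2) (_ * q ^+ 2) T1 T2 T3 T4 => x1 x2 x3 x4.
by lra.
Qed.

End Inequality.

(** * Curvature functions as rational functions of derivatives *)

Local Notation o0 := (@Ordinal 3 0 isT).
Local Notation o1 := (@Ordinal 3 1 isT).
Local Notation o2 := (@Ordinal 3 2 isT).

Section Geometry.
Variable R : realType.

Lemma dotE (u v : 'rV[R]_3) :
  dot u v = u 0 o0 * v 0 o0 + u 0 o1 * v 0 o1 + u 0 o2 * v 0 o2.
Proof.
rewrite /dot !big_ord_recr big_ord0 /= add0r.
by congr (_ * _ + _ * _ + _ * _); congr (_ 0 _); apply/val_inj.
Qed.

Lemma ord3P (P : 'I_3 -> Prop) : P o0 -> P o1 -> P o2 -> forall k, P k.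
Proof.
move=> P0 P1 P2 [[|[|[|//]]] kP].
- by rewrite (_ : Ordinal kP = o0)//; apply/val_inj.
- by rewrite (_ : Ordinal kP = o1)//; apply/val_inj.
- by rewrite (_ : Ordinal kP = o2)//; apply/val_inj.
Qed.

(** The equations of surface theory at one point: Y1, ..., Y22 are the first and second
    derivatives of a parametrization, P its velocity, n the outer normal, and a, b the
    principal curvatures.  In the equations for mean and Gauss curvature the
    second fundamental form is - dot Yij n. *)
Record surface_point (Y1 Y2 Y11 Y12 Y22 P n : 'rV[R]_3) (a b : R) : Prop := {
  sp_unit : dot n n = 1;
  sp_orth1 : dot n Y1 = 0;
  sp_orth2 : dot n Y2 = 0;
  sp_gram : dot Y1 Y1 * dot Y2 Y2 - dot Y1 Y2 ^+ 2 != 0;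
  sp_mean : (a + b) * (dot Y1 Y1 * dot Y2 Y2 - dot Y1 Y2 ^+ 2) =
    - (dot Y2 Y2 * dot Y11 n - 2 * dot Y1 Y2 * dot Y12 n + dot Y1 Y1 * dot Y22 n);
  sp_gauss : a * b * (dot Y1 Y1 * dot Y2 Y2 - dot Y1 Y2 ^+ 2) =
    dot Y11 n * dot Y22 n - dot Y12 n ^+ 2;
  sp_pos1 : 0 < a;
  sp_pos2 : 0 < b;
  sp_speed : P = - (normA2 a b ^+ 2 *: n) }.

(** What continuity at a point and the existence of Taylor expansions have in common.
    The regularity of the curvatures is derived once from these closure properties. *)
Record calculus (I : Type) (F : set_system I) (i0 : I) (C : (I -> R) -> Prop) :
    Prop := {
  cal_cst : forall k, C (fun=> k);
  cal_add : forall f g, C f -> C g -> C (fun i => f i + g i);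
  cal_opp : forall f, C f -> C (fun i => - f i);
  cal_mul : forall f g, C f -> C g -> C (fun i => f i * g i);
  cal_inv : forall f, f i0 != 0 -> C f -> C (fun i => (f i)^-1);
  cal_near : forall f g, (\forall i \near F, f i = g i) -> C f -> C g }.

Definition triple (u v w : 'rV[R]_3) : R :=
  u 0 o0 * (v 0 o1 * w 0 o2 - v 0 o2 * w 0 o1)
  + u 0 o1 * (v 0 o2 * w 0 o0 - v 0 o0 * w 0 o2)
  + u 0 o2 * (v 0 o0 * w 0 o1 - v 0 o1 * w 0 o0).

(** The cross product of v and w is a multiple of n. *)
Lemma triple_normal (u v w n : 'rV[R]_3) : dot n n = 1 -> dot n v = 0 ->
  dot n w = 0 -> triple u v w = triple n v w * dot u n.
Proof.
rewrite !dotE /triple.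
set n0 := n 0 o0; set n1 := n 0 o1; set n2 := n 0 o2.
set u0 := u 0 o0; set u1 := u 0 o1; set u2 := u 0 o2.
set v0 := v 0 o0; set v1 := v 0 o1; set v2 := v 0 o2.
set w0 := w 0 o0; set w1 := w 0 o1; set w2 := w 0 o2.
move=> nn nv nw.
apply/eqP; rewrite -subr_eq0; apply/eqP.
set c0 := v1 * w2 - v2 * w1; set c1 := v2 * w0 - v0 * w2; set c2 := v0 * w1 - v1 * w0.
have e01 : n0 * c1 - n1 * c0 = 0.
  transitivity (w2 * - (n0 * v0 + n1 * v1 + n2 * v2)
    + v2 * (n0 * w0 + n1 * w1 + n2 * w2)); first by rewrite /c0 /c1; ring.
  by rewrite nv nw; ring.
have e12 : n1 * c2 - n2 * c1 = 0.
  transitivity (w0 * - (n0 * v0 + n1 * v1 + n2 * v2)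
    + v0 * (n0 * w0 + n1 * w1 + n2 * w2)); first by rewrite /c2 /c1; ring.
  by rewrite nv nw; ring.
have e20 : n2 * c0 - n0 * c2 = 0.
  transitivity (w1 * - (n0 * v0 + n1 * v1 + n2 * v2)
    + v1 * (n0 * w0 + n1 * w1 + n2 * w2)); first by rewrite /c2 /c0; ring.
  by rewrite nv nw; ring.
transitivity ((u0 * c0 + u1 * c1 + u2 * c2) * (1 - (n0 * n0 + n1 * n1 + n2 * n2))
  - u0 * (n1 * (n0 * c1 - n1 * c0) - n2 * (n2 * c0 - n0 * c2))
  + u1 * (n0 * (n0 * c1 - n1 * c0) - n2 * (n1 * c2 - n2 * c1))
  - u2 * (n0 * (n2 * c0 - n0 * c2) - n1 * (n1 * c2 - n2 * c1))); first by ring.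
by rewrite nn e01 e12 e20; ring.
Qed.

(** The square of a volume is the Gram determinant. *)
Lemma triple_sqr (v w n : 'rV[R]_3) : dot n n = 1 -> dot n v = 0 ->
  dot n w = 0 -> triple n v w ^+ 2 = dot v v * dot w w - dot v w ^+ 2.
Proof.
move=> nn nv nw; pose c : 'rV[R]_3 := \row_k
   if k == o0 then v 0 o1 * w 0 o2 - v 0 o2 * w 0 o1 else
   if k == o1 then v 0 o2 * w 0 o0 - v 0 o0 * w 0 o2 else
   v 0 o0 * w 0 o1 - v 0 o1 * w 0 o0.
have := triple_normal c nn nv nw.
have -> : dot c n = triple n v w by rewrite dotE /triple /c !mxE /=; ring.
by rewrite -expr2 => <-; rewrite /triple !dotE /c !mxE /=; ring.
Qed.

Section Closure.
Variables (I : Type) (F : set_system I) (i0 : I) (C : (I -> R) -> Prop).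
Hypothesis cC : calculus F i0 C.
Hypothesis FF : Filter F.

Lemma cal_sub f g : C f -> C g -> C (fun i => f i - g i).
Proof. by move=> Cf Cg; apply: (cal_add cC) => //; apply: (cal_opp cC). Qed.

Lemma cal_exp f m : C f -> C (fun i => f i ^+ m).
Proof.
move=> Cf; elim: m => [|m IH]; first exact: (cal_cst cC).
have -> : (fun i => f i ^+ m.+1) = (fun i => f i * f i ^+ m).
  by apply/funext => i; rewrite exprS.
exact: (cal_mul cC).
Qed.

Lemma cal_dot (u v : I -> 'rV[R]_3) : (forall k, C (fun i => u i 0 k)) ->
  (forall k, C (fun i => v i 0 k)) -> C (fun i => dot (u i) (v i)).
Proof.
move=> Cu Cv; under eq_fun do rewrite dotE.
by do !apply: (cal_add cC); apply: (cal_mul cC).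
Qed.

Lemma cal_triple (u v w : I -> 'rV[R]_3) : (forall k, C (fun i => u i 0 k)) ->
  (forall k, C (fun i => v i 0 k)) -> (forall k, C (fun i => w i 0 k)) ->
  C (fun i => triple (u i) (v i) (w i)).
Proof.
move=> Cu Cv Cw; rewrite /triple.
by do !apply: (cal_add cC); apply: (cal_mul cC) => //;
  apply: cal_sub; apply: (cal_mul cC).
Qed.

Variables (Y1 Y2 Y11 Y12 Y22 P n : I -> 'rV[R]_3) (a b : I -> R).
Hypothesis geo : \forall i \near F,
  surface_point (Y1 i) (Y2 i) (Y11 i) (Y12 i) (Y22 i) (P i) (n i) (a i) (b i).
Hypothesis geo0 : surface_point (Y1 i0) (Y2 i0) (Y11 i0) (Y12 i0) (Y22 i0)
  (P i0) (n i0) (a i0) (b i0).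
Hypothesis C1 : forall k, C (fun i => Y1 i 0 k).
Hypothesis C2 : forall k, C (fun i => Y2 i 0 k).
Hypothesis C11 : forall k, C (fun i => Y11 i 0 k).
Hypothesis C12 : forall k, C (fun i => Y12 i 0 k).
Hypothesis C22 : forall k, C (fun i => Y22 i 0 k).
Hypothesis CP : forall k, C (fun i => P i 0 k).

Let D i := dot (Y1 i) (Y1 i) * dot (Y2 i) (Y2 i) - dot (Y1 i) (Y2 i) ^+ 2.

Let CD : C D.
Proof.
apply: cal_sub; first by apply: (cal_mul cC); exact: cal_dot.
by apply: cal_exp; exact: cal_dot.
Qed.

Let CVD m : C (fun i => (D i ^+ m)^-1).
Proof.
by apply: (cal_inv cC); [rewrite expf_neq0//; exact: (sp_gram geo0)|exact: cal_exp].
Qed.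

(** The normal enters quadratically, so that n may be replaced by the cross product of
    the tangent vectors, divided by the square root of the Gram determinant, without
    leaving a square root. *)
Lemma cal_gauss : C (fun i => a i * b i).
Proof.
pose l i := triple (Y11 i) (Y1 i) (Y2 i).
pose m i := triple (Y12 i) (Y1 i) (Y2 i).
pose p i := triple (Y22 i) (Y1 i) (Y2 i).
apply: (cal_near cC) (_ : C (fun i => (l i * p i - m i ^+ 2) * (D i ^+ 2)^-1)).
  apply: filterS geo => i [nn n1 n2 gr _ ga _ _ _].
  rewrite /l /m /p (triple_normal (Y11 i) nn n1 n2) (triple_normal (Y12 i) nn n1 n2)
    (triple_normal (Y22 i) nn n1 n2) -/(D i) in gr ga *.
  have E := triple_sqr nn n1 n2; rewrite -/(D i) in E.
  have -> : triple (n i) (Y1 i) (Y2 i) * dot (Y11 i) (n i) *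
      (triple (n i) (Y1 i) (Y2 i) * dot (Y22 i) (n i)) -
      (triple (n i) (Y1 i) (Y2 i) * dot (Y12 i) (n i)) ^+ 2 =
    triple (n i) (Y1 i) (Y2 i) ^+ 2 *
      (dot (Y11 i) (n i) * dot (Y22 i) (n i) - dot (Y12 i) (n i) ^+ 2) by ring.
  by rewrite E -ga; field.
apply: (cal_mul cC) => //; apply: cal_sub; last by apply: cal_exp; exact: cal_triple.
by apply: (cal_mul cC); exact: cal_triple.
Qed.

(** Unlike the mean curvature itself, its square is quadratic in the normal. *)
Lemma cal_mean_sqr : C (fun i => (a i + b i) ^+ 2).
Proof.
pose l i := triple (Y11 i) (Y1 i) (Y2 i).
pose m i := triple (Y12 i) (Y1 i) (Y2 i).
pose p i := triple (Y22 i) (Y1 i) (Y2 i).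
pose q i := dot (Y2 i) (Y2 i) * l i - 2 * dot (Y1 i) (Y2 i) * m i
  + dot (Y1 i) (Y1 i) * p i.
apply: (cal_near cC) (_ : C (fun i => q i ^+ 2 * (D i ^+ 3)^-1)).
  apply: filterS geo => i [nn n1 n2 gr me _ _ _ _].
  rewrite /q /l /m /p (triple_normal (Y11 i) nn n1 n2) (triple_normal (Y12 i) nn n1 n2)
    (triple_normal (Y22 i) nn n1 n2) -/(D i) in gr me *.
  have E := triple_sqr nn n1 n2; rewrite -/(D i) in E.
  set t := triple _ _ _ in E *.
  rewrite (_ : _ - _ + _ = - t * ((a i + b i) * D i)); last by rewrite me; ring.
  by rewrite exprMn sqrrN E; field.
apply: (cal_mul cC) => //; apply: cal_exp; rewrite /q.
apply: (cal_add cC); first apply: cal_sub.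
- by apply: (cal_mul cC); [exact: cal_dot|exact: cal_triple].
- apply: (cal_mul cC); last exact: cal_triple.
  by apply: (cal_mul cC); [exact: (cal_cst cC)|exact: cal_dot].
- by apply: (cal_mul cC); [exact: cal_dot|exact: cal_triple].
Qed.

(** The flow equation recovers the normal from the velocity, because the speed is
    positive and a polynomial in H^2 and K. *)
Lemma cal_normal k : C (fun i => n i 0 k).
Proof.
pose s i := ((a i + b i) ^+ 2 - 2 * (a i * b i)) ^+ 2.
have sE i : s i = normA2 (a i) (b i) ^+ 2 by rewrite /s /normA2; ring.
have s0 i : 0 < a i -> 0 < b i -> s i != 0.
  move=> ai bi; rewrite sE expf_neq0// gt_eqF// /normA2.
  by rewrite addr_gt0// exprn_gt0.
apply: (cal_near cC) (_ : C (fun i => - P i 0 k * (s i)^-1)).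
  apply: filterS geo => i [_ _ _ _ _ _ ai bi ->].
  by rewrite !mxE -sE opprK mulrC mulKf// s0.
apply: (cal_mul cC); first exact: (cal_opp cC).
apply: (cal_inv cC); first by apply: s0; [case: geo0|case: geo0].
apply: cal_exp; apply: cal_sub; first exact: cal_mean_sqr.
by apply: (cal_mul cC); [exact: (cal_cst cC)|exact: cal_gauss].
Qed.

Lemma cal_mean : C (fun i => a i + b i).
Proof.
pose q i := - (dot (Y2 i) (Y2 i) * dot (Y11 i) (n i)
  - 2 * dot (Y1 i) (Y2 i) * dot (Y12 i) (n i) + dot (Y1 i) (Y1 i) * dot (Y22 i) (n i)).
have Cn := cal_normal.
apply: (cal_near cC) (_ : C (fun i => q i * (D i ^+ 1)^-1)).
  apply: filterS geo => i [_ _ _ gr me _ _ _ _].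
  by rewrite /q -me expr1 mulfK.
apply: (cal_mul cC) => //; apply: (cal_opp cC).
apply: (cal_add cC); first apply: cal_sub.
- by apply: (cal_mul cC); exact: cal_dot.
- apply: (cal_mul cC); last exact: cal_dot.
  by apply: (cal_mul cC); [exact: (cal_cst cC)|exact: cal_dot].
- by apply: (cal_mul cC); exact: cal_dot.
Qed.

Lemma pinchingE (x y : R) : pinching x y =
  (((x + y) ^+ 4 - 2 * (x + y) ^+ 2 * (x * y) + 2 * (x * y) ^+ 2)
    * ((x + y) ^+ 2 - 4 * (x * y))) * ((x + y) * (x * y))^-1.
Proof. by rewrite /pinching -[_ * x * y]mulrA; congr (_ / _); ring. Qed.

Lemma cal_pinching : C (fun i => pinching (a i) (b i)).
Proof.
under eq_fun do rewrite pinchingE.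
have [Ch Ck] := (cal_mean, cal_gauss); have Cc := cal_cst cC.
apply: (cal_mul cC).
  apply: (cal_mul cC).
    apply: (cal_add cC); first apply: cal_sub; first exact: cal_exp.
      by apply: (cal_mul cC) => //; apply: (cal_mul cC) => //; exact: cal_exp.
    by apply: (cal_mul cC) => //; exact: cal_exp.
  by apply: cal_sub; [exact: cal_exp|exact: (cal_mul cC)].
apply: (cal_inv cC); last exact: (cal_mul cC).
case: geo0 => _ _ _ _ _ _ ai bi _.
by rewrite gt_eqF// !mulr_gt0// addr_gt0.
Qed.

End Closure.
End Geometry.

(** * Expansions of the curvatures along a line *)

Local Notation "u `_0" := (u 0 o0) (at level 3, format "u `_0").
Local Notation "u `_1" := (u 0 o1) (at level 3, format "u `_1").
Local Notation "u `_2" := (u 0 o2) (at level 3, format "u `_2").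
Local Notation half u := (2^-1 *: u).

Section LineJets.
Variable R : realType.

Definition has_jet (f : R -> R) := exists c, jet f c.

Lemma jet_calculus : calculus (nbhs (0 : R)) 0 has_jet.
Proof.
split.
- by move=> k; eexists; exact: jet_cst.
- by move=> f g [c jc] [d jd]; eexists; exact: jetD jc jd.
- by move=> f [c jc]; eexists; exact: jetN jc.
- by move=> f g [c jc] [d jd]; eexists; exact: jetM jc jd.
- move=> f f0 [c jc]; exists (jinv c); apply: jetV => //.
  by rewrite -(jet_at0 jc).
- by move=> f g fg [c jc]; exists c; exact: jet_near fg jc.
Qed.

Definition jetv (u : R -> 'rV[R]_3) (A B C : 'rV[R]_3) :=
  forall k, jet (fun s => u s 0 k) (A 0 k, B 0 k, C 0 k).

Lemma jet_dot u v A B C A' B' C' : jetv u A B C -> jetv v A' B' C' ->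
  jet (fun s => dot (u s) (v s))
    (dot A A', dot A B' + dot B A', dot A C' + dot B B' + dot C A').
Proof.
move=> ju jv.
have J := jetD (jetD (jetM (ju o0) (jv o0)) (jetM (ju o1) (jv o1)))
  (jetM (ju o2) (jv o2)).
under eq_fun do rewrite dotE.
by apply: (eq_rect _ (jet _) J); rewrite /jadd /jmul/= !dotE; congr (_, _, _); ring.
Qed.

Lemma jet_eq (f g : R -> R) c d : (\forall s \near (0 : R), f s = g s) ->
  jet f c -> jet g d -> [/\ c.1.1 = d.1.1, c.1.2 = d.1.2 & c.2 = d.2].
Proof. by move=> fg jf jg; rewrite (jet_uniq (jet_near fg jf) jg). Qed.

(** First-order consequences of the equations of surface theory along a line through a
    point where the frame is adapted.  A11 and A22 are second derivatives of the
    embedding; X1, X2, X11, X22 are the derivatives along the line of the first and of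
    the pure second derivatives of the embedding; P1, h1, k1, w1 are those of the
    velocity, of H, K and of the pinching quantity w.  L1 and N1 are the derivatives of
    the diagonal entries of the second fundamental form. *)
Definition first_order_law (a b w : R) (A11 A22 X1 X2 X11 X22 P1 : 'rV[R]_3)
    (h1 k1 w1 : R) : Prop :=
  let h := a + b in let k := a * b in
  let L1 := A11`_0 * X1`_2 + A11`_1 * X2`_2 - X11`_2 in
  let N1 := A22`_0 * X1`_2 + A22`_1 * X2`_2 - X22`_2 in
  let s0 := h ^+ 2 - 2 * k in
  let s1 := 2 * h * h1 - 2 * k1 in
  let uh := 6 * h ^+ 5 - 24 * h ^+ 3 * k + 20 * h * k ^+ 2 - w * k in
  let uk := - 6 * h ^+ 4 + 20 * h ^+ 2 * k - 24 * k ^+ 2 - w * h in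
  [/\ h1 = L1 + N1 - a * (2 * X1`_0) - b * (2 * X2`_1),
      k1 = b * L1 + a * N1 - k * (2 * X1`_0 + 2 * X2`_1),
      [/\ P1`_0 = s0 ^+ 2 * X1`_2, P1`_1 = s0 ^+ 2 * X2`_2 &
          P1`_2 = - (2 * s0 * s1)] &
      w1 * (h * k) = uh * h1 + uk * k1].

(** The second Taylor coefficients.  A prime marks the second coefficient of the
    same quantity; m0, m1, m2 are those of the components of the normal, and E, F, G and
    L, M, N are the first and second fundamental forms. *)
Definition second_order_law (a b w : R) (A11 A12 A22 X1 X2 X11 X12 X22
    X1' X2' X11' X22' P2 : 'rV[R]_3) (h1 h2 k1 k2 w1 w2 : R) : Prop :=
  let h := a + b in let k := a * b in
  let L1 := A11`_0 * X1`_2 + A11`_1 * X2`_2 - X11`_2 in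
  let M1 := A12`_0 * X1`_2 + A12`_1 * X2`_2 - X12`_2 in
  let N1 := A22`_0 * X1`_2 + A22`_1 * X2`_2 - X22`_2 in
  let m0 := X1`_2 * X1`_0 + X2`_2 * X1`_1 - X1'`_2 in
  let m1 := X1`_2 * X2`_0 + X2`_2 * X2`_1 - X2'`_2 in
  let m2 := - (X1`_2 ^+ 2 + X2`_2 ^+ 2) / 2 in
  let L2 := X11`_0 * X1`_2 + X11`_1 * X2`_2 - X11'`_2
    - (A11`_0 * m0 + A11`_1 * m1 - a * m2) in
  let N2 := X22`_0 * X1`_2 + X22`_1 * X2`_2 - X22'`_2
    - (A22`_0 * m0 + A22`_1 * m1 - b * m2) in
  let E1 := 2 * X1`_0 in let G1 := 2 * X2`_1 in let F1 := X1`_1 + X2`_0 in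
  let E2 := 2 * X1'`_0 + dot X1 X1 in let G2 := 2 * X2'`_1 + dot X2 X2 in
  let D1 := E1 + G1 in let D2 := E2 + G2 + E1 * G1 - F1 ^+ 2 in
  let s0 := h ^+ 2 - 2 * k in
  let s1 := 2 * h * h1 - 2 * k1 in
  let s2 := h1 ^+ 2 + 2 * h * h2 - 2 * k2 in
  let uh := 6 * h ^+ 5 - 24 * h ^+ 3 * k + 20 * h * k ^+ 2 - w * k in
  let uk := - 6 * h ^+ 4 + 20 * h ^+ 2 * k - 24 * k ^+ 2 - w * h in
  let uhh := 30 * h ^+ 4 - 72 * h ^+ 2 * k + 20 * k ^+ 2 in
  let uhk := - 24 * h ^+ 3 + 40 * h * k - w in
  let ukk := 20 * h ^+ 2 - 48 * k in
  [/\ h2 = L2 + G1 * L1 + G2 * a - 2 * F1 * M1 + N2 + E1 * N1 + E2 * b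
        - h1 * D1 - h * D2,
      k2 = b * L2 + L1 * N1 + a * N2 - M1 ^+ 2 - k1 * D1 - k * D2,
      P2`_2 = - (s1 ^+ 2 + 2 * s0 * s2) - s0 ^+ 2 * m2 &
      2 * w2 * (h * k) + 2 * w1 * (h * k1 + h1 * k) =
        2 * (uh * h2 + uk * k2) + uhh * h1 ^+ 2 + 2 * uhk * h1 * k1
        + ukk * k1 ^+ 2].

Definition frame (i : 'I_3) : 'rV[R]_3 := delta_mx 0 i.

(** Every pointwise equation of the surface, read as an equation between Taylor
    expansions along the line, yields equations between coefficients; those of
    the normal are found first, from n . n = 1 and n . Yi = 0. *)
Theorem line_jets (Y1 Y2 Y11 Y12 Y22 P n : R -> 'rV[R]_3) (la lb : R -> R)
    (a b : R) (X1 X1' X2 X2' A11 X11 X11' A12 X12 X12' A22 X22 X22'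
     P0 P1 P2 : 'rV[R]_3) :
  (\forall s \near (0 : R), surface_point (Y1 s) (Y2 s) (Y11 s) (Y12 s) (Y22 s)
     (P s) (n s) (la s) (lb s)) ->
  jetv Y1 (frame o0) X1 X1' -> jetv Y2 (frame o1) X2 X2' ->
  jetv Y11 A11 X11 X11' -> jetv Y12 A12 X12 X12' -> jetv Y22 A22 X22 X22' ->
  jetv P P0 P1 P2 -> n 0 = frame o2 -> la 0 = a -> lb 0 = b ->
  A11`_2 = - a -> A12`_2 = 0 -> A22`_2 = - b ->
  exists h1 h2 k1 k2 w1 w2,
  [/\ jet (fun s => pinching (la s) (lb s)) (pinching a b, w1, w2),
      first_order_law a b (pinching a b) A11 A22 X1 X2 X11 X22 P1 h1 k1 w1 &
      second_order_law a b (pinching a b) A11 A12 A22 X1 X2 X11 X12 X22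
        X1' X2' X11' X22' P2 h1 h2 k1 k2 w1 w2].
Proof.
move=> geo j1 j2 j11 j12 j22 jP n0 la0 lb0 A11n A12n A22n.
have geo0 := nbhs_singleton geo.
have hv u A B D : jetv u A B D -> forall k, has_jet (fun s => u s 0 k).
  by move=> ju k; eexists; exact: ju.
have C1 := hv _ _ _ _ j1; have C2 := hv _ _ _ _ j2; have C11 := hv _ _ _ _ j11.
have C12 := hv _ _ _ _ j12; have C22 := hv _ _ _ _ j22; have CP := hv _ _ _ _ jP.
have FF := nbhs_filter (0 : R).
have [h' jh] := cal_mean jet_calculus FF geo geo0 C1 C2 C11 C12 C22 CP.
have [k' jk] := cal_gauss jet_calculus FF geo geo0 C1 C2 C11 C12 C22.
have [w' jw] := cal_pinching jet_calculus FF geo geo0 C1 C2 C11 C12 C22 CP.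
have Cn := cal_normal jet_calculus FF geo geo0 C1 C2 C11 C12 C22 CP.
have jn : exists n1 n2, jetv n (frame o2) n1 n2.
  exists (\row_k (sval (cid (Cn k))).1.2), (\row_k (sval (cid (Cn k))).2) => k.
  have jc := svalP (cid (Cn k)); rewrite -n0 (jet_at0 jc) !mxE.
  by move: (sval _) jc => [[? ?] ?].
case: jn => n1 [n2 jn].
have := jet_at0 jh; have := jet_at0 jk; have := jet_at0 jw; rewrite la0 lb0.
case: h' jh => [[h h1] h2] jh /=; case: k' jk => [[k k1] k2] jk /=.
case: w' jw => [[w w1] w2] jw /= ew ek eh; move: jh jk jw.
rewrite -ew -ek -eh => jh jk jw {w k h ew ek eh}.
exists h1, h2, k1, k2, w1, w2.
have fr1 (u : 'rV[R]_3) : dot (frame o0) u = u`_0 by rewrite dotE /frame !mxE /=; ring.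
have fr2 (u : 'rV[R]_3) : dot (frame o1) u = u`_1 by rewrite dotE /frame !mxE /=; ring.
have fr3 (u : 'rV[R]_3) : dot (frame o2) u = u`_2 by rewrite dotE /frame !mxE /=; ring.
have dC (u v : 'rV[R]_3) : dot u v = dot v u by rewrite !dotE; ring.
have fr1' (u : 'rV[R]_3) : dot u (frame o0) = u`_0 by rewrite dC ?fr1 ?fr2 ?fr3.
have fr2' (u : 'rV[R]_3) : dot u (frame o1) = u`_1 by rewrite dC ?fr1 ?fr2 ?fr3.
have fr3' (u : 'rV[R]_3) : dot u (frame o2) = u`_2 by rewrite dC ?fr1 ?fr2 ?fr3.
have [_ u1 u2] : [/\ 1 = 1 :> R, n1`_2 = 0 & n2`_2 = - (n1`_0 ^+ 2 + n1`_1 ^+ 2) / 2].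
  have E : \forall s \near (0 : R), dot (n s) (n s) = 1.
    by apply: filterS geo => s [].
  have [_ /= E1 E2] := jet_eq E (jet_dot jn jn) (jet_cst 1).
  move: E1 E2; rewrite !fr3 !fr3' => E1 E2; have E3 : n1`_2 = 0 by lra.
  split=> //; move: E2; rewrite [dot n1 n1]dotE E3 => E2; lra.
have [v1 v2] : n1`_0 = - X1`_2 /\
    n2`_0 = - X1'`_2 - n1`_0 * X1`_0 - n1`_1 * X1`_1.
  have E : \forall s \near (0 : R), dot (n s) (Y1 s) = 0.
    by apply: filterS geo => s [].
  have [_ /= E1 E2] := jet_eq E (jet_dot jn j1) (jet_cst 0).
  move: E1 E2; rewrite !fr3 !fr1' => E1 E2.
  by move: E2; rewrite [dot n1 _]dotE u1 => E2; split; lra.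
have [x1 x2] : n1`_1 = - X2`_2 /\
    n2`_1 = - X2'`_2 - n1`_0 * X2`_0 - n1`_1 * X2`_1.
  have E : \forall s \near (0 : R), dot (n s) (Y2 s) = 0.
    by apply: filterS geo => s [].
  have [_ /= E1 E2] := jet_eq E (jet_dot jn j2) (jet_cst 0).
  move: E1 E2; rewrite !fr3 !fr2' => E1 E2.
  by move: E2; rewrite [dot n1 _]dotE u1 => E2; split; lra.
have jE := jet_dot j1 j1; have jF := jet_dot j1 j2; have jG := jet_dot j2 j2.
have jL := jet_dot j11 jn; have jM := jet_dot j12 jn; have jN := jet_dot j22 jn.
have jD := jetD (jetM jE jG) (jetN (jetM jF jF)).
have [Eh1 Eh2] : [/\ h1 = A11`_0 * X1`_2 + A11`_1 * X2`_2 - X11`_2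
      + (A22`_0 * X1`_2 + A22`_1 * X2`_2 - X22`_2)
      - a * (2 * X1`_0) - b * (2 * X2`_1) &
    (a + b) * (2 * X2'`_1 + dot X2 X2 + 4 * X1`_0 * X2`_1 + 2 * X1'`_0 + dot X1 X1
       - (X2`_0 + X1`_1) ^+ 2) + h1 * (2 * X2`_1 + 2 * X1`_0) + h2 =
    - (dot A11 n2 + dot X11 n1 + X11'`_2 + 2 * X2`_1 * (dot A11 n1 + X11`_2)
       - (2 * X2'`_1 + dot X2 X2) * a
       - 2 * (X2`_0 + X1`_1) * (dot A12 n1 + X12`_2)
       + dot A22 n2 + dot X22 n1 + X22'`_2 + 2 * X1`_0 * (dot A22 n1 + X22`_2)
       - (2 * X1'`_0 + dot X1 X1) * b)].
  have E : \forall s \near (0 : R), (la s + lb s) *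
     (dot (Y1 s) (Y1 s) * dot (Y2 s) (Y2 s) - dot (Y1 s) (Y2 s) * dot (Y1 s) (Y2 s))
     = - (dot (Y2 s) (Y2 s) * dot (Y11 s) (n s)
         + - ((2 * dot (Y1 s) (Y2 s)) * dot (Y12 s) (n s))
         + dot (Y1 s) (Y1 s) * dot (Y22 s) (n s)).
    by apply: filterS geo => s []; rewrite expr2.
  have [_ /= E1 E2] := jet_eq E (jetM jh jD)
    (jetN (jetD (jetD (jetM jG jL) (jetN (jetM (jetM (jet_cst 2) jF) jM))) (jetM jE jN))).
  move: E1 E2; rewrite ?fr1 ?fr2 ?fr3 ?fr1' ?fr2' ?fr3' /frame !mxE /= A11n A12n A22n.
  rewrite (dotE A11 n1) (dotE A22 n1) u1 v1 x1 => E1 E2; split; lra.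
have [Ek1 Ek2] : [/\ k1 = b * (A11`_0 * X1`_2 + A11`_1 * X2`_2 - X11`_2)
      + a * (A22`_0 * X1`_2 + A22`_1 * X2`_2 - X22`_2)
      - a * b * (2 * X1`_0 + 2 * X2`_1) &
    (a * b) * (2 * X2'`_1 + dot X2 X2 + 4 * X1`_0 * X2`_1 + 2 * X1'`_0 + dot X1 X1
       - (X2`_0 + X1`_1) ^+ 2) + k1 * (2 * X2`_1 + 2 * X1`_0) + k2 =
    - a * (dot A22 n2 + dot X22 n1 + X22'`_2)
    + (dot A11 n1 + X11`_2) * (dot A22 n1 + X22`_2)
    - b * (dot A11 n2 + dot X11 n1 + X11'`_2) - (dot A12 n1 + X12`_2) ^+ 2].
  have E : \forall s \near (0 : R), (la s * lb s) *
     (dot (Y1 s) (Y1 s) * dot (Y2 s) (Y2 s) - dot (Y1 s) (Y2 s) * dot (Y1 s) (Y2 s))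
     = dot (Y11 s) (n s) * dot (Y22 s) (n s)
      + - (dot (Y12 s) (n s) * dot (Y12 s) (n s)).
    by apply: filterS geo => s []; rewrite !expr2.
  have [_ /= E1 E2] := jet_eq E (jetM jk jD)
    (jetD (jetM jL jN) (jetN (jetM jM jM))).
  move: E1 E2; rewrite ?fr1 ?fr2 ?fr3 ?fr1' ?fr2' ?fr3' /frame !mxE /= A11n A12n A22n.
  rewrite (dotE A11 n1) (dotE A22 n1) u1 v1 x1 => E1 E2; split; lra.
have jS := jetD (jetM jh jh) (jetN (jetM (jet_cst 2) jk)).
have EP k : \forall s \near (0 : R), P s 0 k =
    - ((((la s + lb s) * (la s + lb s) + - (2 * (la s * lb s)))
      * ((la s + lb s) * (la s + lb s) + - (2 * (la s * lb s)))) * n s 0 k).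
  apply: filterS geo => s [_ _ _ _ _ _ _ _ ->]; rewrite !mxE /normA2; ring.
have jP' k := jet_eq (EP k) (jP k) (jetN (jetM (jetM jS jS) (jn k))).
have [_ /= p0 _] := jP' o0; have [_ /= p1 _] := jP' o1; have [_ /= p2 p3] := jP' o2.
move: p0 p1 p2 p3; rewrite /frame !mxE /= u1 u2 v1 x1 => p0 p1 p2 p3.
have [a0 b0] : 0 < a /\ 0 < b by rewrite -la0 -lb0; case: geo0.
have Ew : \forall s \near (0 : R), pinching (la s) (lb s) *
    ((la s + lb s) * (la s * lb s)) =
    ((la s + lb s) * (la s + lb s) * ((la s + lb s) * (la s + lb s)) +
     - (2 * ((la s + lb s) * (la s + lb s)) * (la s * lb s)) +
     2 * ((la s * lb s) * (la s * lb s))) *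
    ((la s + lb s) * (la s + lb s) + - (4 * (la s * lb s))).
  apply: filterS geo => s [_ _ _ _ _ _ ai bi _].
  rewrite pinchingE; field.
  by rewrite !gt_eqF// addr_gt0.
have jhh := jetM jh jh.
have [_ /= Ew1 Ew2] := jet_eq Ew (jetM jw (jetM jh jk))
  (jetM (jetD (jetD (jetM jhh jhh) (jetN (jetM (jetM (jet_cst 2) jhh) jk)))
      (jetM (jet_cst 2) (jetM jk jk))) (jetD jhh (jetN (jetM (jet_cst 4) jk)))).
split=> //; move: (pinching a b) Ew1 Ew2 => w0 Ew1 Ew2.
  rewrite /first_order_law; split.
  - exact: Eh1.
  - exact: Ek1.
  - by split; [rewrite p0|rewrite p1|rewrite p2]; ring.
  - by move: Ew1; clear; lra.
rewrite /second_order_law; split.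
- move: Eh2; rewrite !(dotE _ n1) !(dotE _ n2) u1 u2 v2 x2 v1 x1 A11n A22n.
  by clear; lra.
- move: Ek2; rewrite !(dotE _ n1) !(dotE _ n2) u1 u2 v2 x2 v1 x1 A11n A22n.
  by clear; lra.
- by rewrite p3; ring.
- by move: Ew2; clear; lra.
Qed.

End LineJets.

(** * Time derivative at a spatial maximum, algebraically *)

Section Evolution.
Variable R : realType.

(** The first-order law holds along the two tangent directions and along time, the
    second-order law along the tangent directions.  Numbered indices are derivatives
    of the embedding, and Z stands for the derivatives of its velocity; writing the same variable in two laws, as Y112 or Z11, encodes that the
    derivatives commute. *)
Theorem pinching_decreases (a b : R)
    (Y11 Y12 Y22 Y111 Y112 Y122 Y222 Y1111 Y1122 Y2222 : 'rV[R]_3)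
    (Z1 Z2 Z11 Z22 Q : 'rV[R]_3)
    (h1 h2 k1 k2 w1 w2 h1' h2' k1' k2' w1' w2' ht kt wt : R) :
  0 < a -> 0 < b -> a != b ->
  Y11`_2 = - a -> Y12`_2 = 0 -> Y22`_2 = - b ->
  let w := pinching a b in
  first_order_law a b w Y11 Y22 Y11 Y12 Y111 Y122 Z1 h1 k1 w1 ->
  second_order_law a b w Y11 Y12 Y22 Y11 Y12 Y111 Y112 Y122
    (half Y111) (half Y112) (half Y1111) (half Y1122) (half Z11) h1 h2 k1 k2 w1 w2 ->
  first_order_law a b w Y11 Y22 Y12 Y22 Y112 Y222 Z2 h1' k1' w1' ->
  second_order_law a b w Y11 Y12 Y22 Y12 Y22 Y112 Y122 Y222
    (half Y122) (half Y222) (half Y1122) (half Y2222) (half Z22)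
    h1' h2' k1' k2' w1' w2' ->
  first_order_law a b w Y11 Y22 Z1 Z2 Z11 Z22 Q ht kt wt ->
  w1 = 0 -> w2 <= 0 -> w1' = 0 -> w2' <= 0 -> wt <= 0.
Proof.
move=> a0 b0 ab A11n A12n A22n w.
move=> [Eh1 Ek1 [Z10 Z11' Z12] Ew1] [Eh2 Ek2 EZ11 Ew2].
move=> [Eh1' Ek1' [Z20 Z21 Z22'] Ew1'] [Eh2' Ek2' EZ22 Ew2'].
move=> [Eht Ekt _ Ewt] w10 w20 w10' w20'.
have hk0 : 0 < (a + b) * (a * b) by rewrite !mulr_gt0// addr_gt0.
have ab0 : a - b != 0 by rewrite subr_eq0.
(* The covariant derivatives h_ij;k: the Christoffel symbols are the tangential
   components of Y11, Y12 and Y22. *)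
pose c0 := - Y111`_2 - 3 * a * Y11`_0.
pose c1 := - Y112`_2 - b * Y11`_1 - 2 * a * Y12`_0.
pose c2 := - Y122`_2 - a * Y22`_0 - 2 * b * Y12`_1.
pose c3 := - Y222`_2 - 3 * b * Y22`_1.
have {Eh1}Eh1 : h1 = c0 + c2.
  by rewrite Eh1 /c0 /c2 A11n A12n; ring.
have {Ek1}Ek1 : k1 = b * c0 + a * c2.
  by rewrite Ek1 /c0 /c2 A11n A12n; ring.
have {Eh1'}Eh1' : h1' = c1 + c3.
  by rewrite Eh1' /c1 /c3 A12n A22n; ring.
have {Ek1'}Ek1' : k1' = b * c1 + a * c3.
  by rewrite Ek1' /c1 /c3 A12n A22n; ring.
(* Covariant second derivatives of H and K. *)
pose H11 := 2 * h2 - Y11`_0 * h1 - Y11`_1 * h1'.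
pose K11 := 2 * k2 - Y11`_0 * k1 - Y11`_1 * k1'.
pose H22 := 2 * h2' - Y22`_0 * h1 - Y22`_1 * h1'.
pose K22 := 2 * k2' - Y22`_0 * k1 - Y22`_1 * k1'.
(* h_22;11 and h_11;22, solved from H_;11, K_;11 and from H_;22, K_;22. *)
pose r1 := (K11 - b * H11 - 2 * (c0 * c2 - c1 ^+ 2)) / (a - b).
pose p2 := (a * H22 - K22 + 2 * (c1 * c3 - c2 ^+ 2)) / (a - b).
(* Simons' identity. *)
have Ep : p2 = r1 + a * b * (a - b).
  apply: (mulIf ab0); rewrite mulrDl !divfK// /H11 /H22 /K11 /K22.
  rewrite Ek2 Eh2 Ek2' Eh2' Ek1 Eh1 Ek1' Eh1' !dotE !mxE A11n A12n A22n /c0 /c1 /c2 /c3.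
  by field.
have wE : w * ((a + b) * (a * b)) =
  ((a + b) ^+ 4 - 2 * (a + b) ^+ 2 * (a * b) + 2 * (a * b) ^+ 2)
   * ((a + b) ^+ 2 - 4 * (a * b)).
  by rewrite /w pinchingE divfK// gt_eqF.
have := @pinching_inequality R a b c0 c1 c2 c3 (H11 - r1) r1 p2 (H22 - p2) w
  a0 b0 ab wE Ep.
rewrite -Eh1 -Eh1' -Ek1 -Ek1' -Ew1 -Ew1' w10 w10' mul0r subrK [p2 + _]addrC subrK.
have -> : b * (H11 - r1) + a * r1 + 2 * (c0 * c2 - c1 ^+ 2) = K11.
  by rewrite /r1; field.
have -> : b * p2 + a * (H22 - p2) + 2 * (c1 * c3 - c2 ^+ 2) = K22.
  by rewrite /p2; field.
move=> /(_ erefl erefl) main.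
rewrite -(pmulr_rle0 _ hk0) mulrC Ewt.
clear c0 c1 c2 c3 r1 p2 Ep Eh1 Ek1 Eh1' Ek1' Eh2 Ek2 Eh2' Ek2'.
set uh := _ - w * (a * b) in main Ew1 Ew1' Ew2 Ew2' *.
set uk := _ - w * (a + b) in main Ew1 Ew1' Ew2 Ew2' *.
set s := (a + b) ^+ 2 - 2 * (a * b) in main Z10 Z11' Z12 Z20 Z21 Z22' EZ11 EZ22.
set s1 := 2 * (a + b) * h1 - 2 * k1 in main Z12 EZ11.
set s2 := 2 * (a + b) * h1' - 2 * k1' in main Z22' EZ22.
rewrite w10 in Ew1 Ew2; rewrite w10' in Ew1' Ew2'.
have {}main := main _ _.
apply: le_trans (main _ _).
- (* The evolution equations of H and K. *)
  have Z11n : Z11`_2 = - (2 * s1 ^+ 2 + 2 * s * (2 * (a + b) * (2 * h2) + 2 * h1 ^+ 2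
       - 2 * (2 * k2))) + s ^+ 2 * a ^+ 2.
    have := EZ11; rewrite !mxE A11n A12n => E; lra.
  have Z22n : Z22`_2 = - (2 * s2 ^+ 2 + 2 * s * (2 * (a + b) * (2 * h2') + 2 * h1' ^+ 2
       - 2 * (2 * k2'))) + s ^+ 2 * b ^+ 2.
    have := EZ22; rewrite !mxE A22n A12n => E; lra.
  rewrite le_eqVlt; apply/orP; left; apply/eqP; congr (_ * _ + _ * _).
    rewrite Eht Z11n Z22n Z10 Z21 Z12 Z22' A11n A22n /H11 /K11 /H22 /K22 /s /s1 /s2.
    ring.
  rewrite Ekt Z11n Z22n Z10 Z21 Z12 Z22' A11n A22n /H11 /K11 /H22 /K22 /s /s1 /s2.
  ring.
- apply: le_trans (_ : 2 * w2 * ((a + b) * (a * b)) <= 0).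
    rewrite le_eqVlt; apply/orP; left; apply/eqP.
    move: Ew2; rewrite mulr0 mul0r addr0 => ->.
    transitivity (2 * (uh * h2 + uk * k2) - Y11`_0 * (uh * h1 + uk * k1)
      - Y11`_1 * (uh * h1' + uk * k1') + (30 * (a + b) ^+ 4 - 72 * (a + b) ^+ 2 * (a * b)
      + 20 * (a * b) ^+ 2) * h1 ^+ 2
      + 2 * (-24 * (a + b) ^+ 3 + 40 * (a + b) * (a * b) - w) * h1 * k1 +
      (20 * (a + b) ^+ 2 - 48 * (a * b)) * k1 ^+ 2); first by rewrite /H11 /K11; ring.
    by rewrite -Ew1 -Ew1'; ring.
  by rewrite mulr_le0_ge0 ?(ltW hk0)// mulr_ge0_le0.
- apply: le_trans (_ : 2 * w2' * ((a + b) * (a * b)) <= 0).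
    rewrite le_eqVlt; apply/orP; left; apply/eqP.
    move: Ew2'; rewrite mulr0 mul0r addr0 => ->.
    transitivity (2 * (uh * h2' + uk * k2') - Y22`_0 * (uh * h1 + uk * k1)
      - Y22`_1 * (uh * h1' + uk * k1') + (30 * (a + b) ^+ 4 - 72 * (a + b) ^+ 2 * (a * b)
      + 20 * (a * b) ^+ 2) * h1' ^+ 2
      + 2 * (-24 * (a + b) ^+ 3 + 40 * (a + b) * (a * b) - w) * h1' * k1' +
      (20 * (a + b) ^+ 2 - 48 * (a * b)) * k1' ^+ 2); first by rewrite /H22 /K22; ring.
    by rewrite -Ew1 -Ew1'; ring.
  by rewrite mulr_le0_ge0 ?(ltW hk0)// mulr_ge0_le0.
Qed.

End Evolution.

(** * Time derivative at a spatial maximum, analytically *)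

Section Core.
Variable R : realType.
Variable V : normedModType R.

Lemma derive_coord n (f : V -> 'rV[R]_n) x v k : differentiable f x ->
  'D_v (fun y => f y 0 k) x = ('D_v f x) 0 k.
Proof.
by move=> df; rewrite derive_mx ?mxE//; exact: diff_derivable.
Qed.

Lemma Ck_coord n m (U : set V) (f : V -> 'rV[R]_n) k : open U ->
  Ck m U f -> Ck m U (fun y => f y 0 k).
Proof.
move=> oU Cf; pose c (w : 'rV[R]_n) : R := w 0 k.
have lc : linear c by move=> a u v; rewrite /c !mxE.
pose cM := GRing.isLinear.Build _ _ _ _ _ lc.
pose cL : {linear 'rV[R]_n -> R} := HB.pack c cM.
by apply: (@Ck_linear_post _ _ _ _ _ _ cL) => // w; exact: coord_continuous.
Qed.

Variable U : set V.
Hypothesis oU : open U.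

Lemma derive_congr (W : normedModType R) (f g : V -> W) v :
  (forall z, U z -> f z = g z) -> forall z, U z -> 'D_v f z = 'D_v g z.
Proof. by move=> fg z Uz; apply: near_eq_derive; exact: open_near oU Uz fg. Qed.

Lemma derive2_coord n (f : V -> 'rV[R]_n) v w k x : Ck 2 U f -> U x ->
  'D_w (fun y => 'D_v (fun z => f z 0 k) y) x = ('D_w (fun y => 'D_v f y) x) 0 k.
Proof.
move=> Cf Ux; rewrite -derive_coord; last first.
  by have [_ /(_ v) [dDf _]] := Cf; exact: dDf.
apply: derive_congr => // z Uz; apply: derive_coord.
by have [df _] := Cf; exact: df.
Qed.

Lemma derive_comm_rV n (f : V -> 'rV[R]_n) v w : Ck 2 U f ->
  forall z, U z -> 'D_w (fun y => 'D_v f y) z = 'D_v (fun y => 'D_w f y) z.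
Proof.
move=> Cf z Uz; apply/rowP => k.
refine (etrans (esym (derive2_coord v w k Cf Uz)) (etrans _ (derive2_coord w v k Cf Uz))).
exact: (derive_comm v w oU Uz (Ck_coord k oU Cf)).
Qed.

Lemma Ck_jetv (f : V -> 'rV[R]_3) x v : U x -> Ck 2 U f ->
  jetv (fun s => f (x + s *: v)) (f x) ('D_v f x)
    (half ('D_v (fun y => 'D_v f y) x)).
Proof.
move=> Ux Cf k; have [df _] := Cf.
have := Ck_jet v oU Ux (Ck_coord k oU Cf).
by rewrite (derive2_coord v v k Cf Ux) (derive_coord v k (df x Ux)) mxE mulrC.
Qed.

Lemma line_near x v (P : V -> Prop) : U x -> (forall z, U z -> P z) ->
  \forall s \near (0 : R), P (x + s *: v).
Proof.
move=> Ux UP; have c : (fun s : R => x + s *: v) @ (0 : R) --> x.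
  have : x + s *: v @[s --> (0 : R)] --> x + 0 *: v.
    by apply: cvgD; [exact: cvg_cst|apply: cvgZr_tmp].
  by rewrite scale0r addr0.
exact: (c P (open_near oU Ux UP)).
Qed.

(** Taylor expansions of the derivatives of y along the three lines supply the
    coefficients of the algebraic statement; the symmetry of second derivatives
    identifies those that occur on more than one line. *)
Theorem pinching_core (x e1 e2 et : V) (y n : V -> 'rV[R]_3) (la lb : V -> R) :
  U x -> Ck 6 U y ->
  let d v f := fun z : V => 'D_v (f : V -> 'rV[R]_3) z in
  (forall z, U z -> surface_point (d e1 y z) (d e2 y z) (d e1 (d e1 y) z)
     (d e1 (d e2 y) z) (d e2 (d e2 y) z) (d et y z) (n z) (la z) (lb z)) ->
  d e1 y x = frame _ o0 -> d e2 y x = frame _ o1 -> n x = frame _ o2 ->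
  d e1 (d e1 y) x 0 o2 = - la x -> d e1 (d e2 y) x 0 o2 = 0 ->
  d e2 (d e2 y) x 0 o2 = - lb x -> la x != lb x ->
  let w z := pinching (la z) (lb z) in
  (\forall s \near (0 : R), w (x + s *: e1) <= w x) ->
  (\forall s \near (0 : R), w (x + s *: e2) <= w x) ->
  exists c, jet (fun s => w (x + s *: et)) c /\ c.1.2 <= 0.
Proof.
move=> Ux Cy d geo f1 f2 f3 A11n A12n A22n ab w max1 max2.
have Cd k f v : Ck k.+1 U f -> Ck k U (d v f) by case=> _; exact.
have Cw k f : Ck k.+1 U f -> Ck k U f by exact: CkW.
have comm f v u : Ck 2 U f -> forall z, U z -> d v (d u f) z = d u (d v f) z.
  by move=> Cf z Uz; exact: derive_comm_rV.
have congr f g v : (forall z, U z -> f z = g z) ->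
  forall z, U z -> d v f z = d v g z by move=> fg; exact: derive_congr.
have x0 v : x + 0 *: v = x by rewrite scale0r addr0.
have C5 v : Ck 5 U (d v y) by exact: Cd.
have C4 v u : Ck 4 U (d v (d u y)) by exact/Cd/C5.
have C3 t v u : Ck 3 U (d t (d v (d u y))) by exact/Cd/C4.
have jv v f : Ck 2 U f -> jetv (fun s => f (x + s *: v)) (f x) (d v f x)
    (half (d v (d v f) x)) by move=> Cf; exact: Ck_jetv.
have C2 t v u : Ck 2 U (d t (d v (d u y))) by exact/Cw.
have C42 v u : Ck 2 U (d v (d u y)) by exact/Cw/Cw.
have C52 v : Ck 2 U (d v y) by exact/Cw/Cw/Cw.
have J1 v := jv v _ (C52 e1); have J2 v := jv v _ (C52 e2).
rewrite f1 in J1; rewrite f2 in J2.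
have line v := line_jets (line_near v Ux geo) (J1 v) (J2 v)
  (jv v _ (C42 e1 e1)) (jv v _ (C42 e1 e2)) (jv v _ (C42 e2 e2)) (jv v _ (C52 et))
  (etrans (congr1 n (x0 v)) f3) (congr1 la (x0 v)) (congr1 lb (x0 v)) A11n A12n A22n.
have [h1 [h2 [k1 [k2 [w1 [w2 [jw1 fo1 so1]]]]]]] := line e1.
have [h1' [h2' [k1' [k2' [w1' [w2' [jw2 fo2 so2]]]]]]] := line e2.
have [ht [_ [kt [_ [wt [wt2 [jwt fot _]]]]]]] := line et.
have C2y : Ck 2 U y := CkW (CkW (CkW (CkW Cy))).
(* Mixed derivatives are brought to the form d e1 (... (d e2 ...)), with time
   innermost. *)
have s12 : forall z, U z -> d e2 (d e1 y) z = d e1 (d e2 y) z := comm y e2 e1 C2y.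
have s122 : forall z, U z -> d e2 (d e1 (d e2 y)) z = d e1 (d e2 (d e2 y)) z.
  exact: (comm (d e2 y) e2 e1 (C52 e2)).
have s221 z (Uz : U z) : d e2 (d e2 (d e1 y)) z = d e1 (d e2 (d e2 y)) z.
  exact: (etrans (congr _ _ e2 s12 z Uz) (s122 z Uz)).
have s112 z (Uz : U z) : d e2 (d e1 (d e1 y)) z = d e1 (d e1 (d e2 y)) z.
  exact: (etrans (comm (d e1 y) e2 e1 (C52 e1) z Uz) (congr _ _ e1 s12 z Uz)).
have s2211 z (Uz : U z) :
    d e2 (d e2 (d e1 (d e1 y))) z = d e1 (d e1 (d e2 (d e2 y))) z.
  apply: (etrans (congr _ _ e2 s112 z Uz)).
  exact: (etrans (comm _ e2 e1 (C42 e1 e2) z Uz) (congr _ _ e1 s122 z Uz)).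
have t1 v z (Uz : U z) : d et (d v y) z = d v (d et y) z := comm y et v C2y z Uz.
have t11 v z (Uz : U z) : d et (d v (d v y)) z = d v (d v (d et y)) z.
  exact: (etrans (comm _ et v (C52 v) z Uz) (congr _ _ v (t1 v) z Uz)).
clearbody d.
move: fo1 so1 fo2 so2 fot.
rewrite (s12 _ Ux) (s122 _ Ux) (s221 _ Ux) (s112 _ Ux) (s2211 _ Ux).
rewrite !(t1 _ _ Ux) !(t11 _ _ Ux).
move=> fo1 so1 fo2 so2 fot.
have [_ _ _ _ _ _ a0 b0 _] := geo x Ux.
have m1 := jet_max jw1; have m2 := jet_max jw2; rewrite /= !x0 in m1 m2.
have [w10 w20] := m1 max1; have [w10' w20'] := m2 max2.
exists (pinching (la x) (lb x), wt, wt2); split=> //=.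
exact: (pinching_decreases a0 b0 ab A11n A12n A22n fo1 so1 fo2 so2 fot).
Qed.
End Core.

(** * Local parametrizations moving with the flow *)

Section Charts.
Variable R : realType.
Implicit Types V W Z : normedModType R.

Lemma open_preimage V W (U : set V) (O : set W) (f : V -> W) : open U -> open O ->
  Ck 0 U f -> open (U `&` f @^-1` O).
Proof.
move=> oU oO cf; rewrite openE => x [Ux Ofx]; apply: filterI.
  exact: open_nbhs_nbhs.
by apply: (cf x Ux); exact: open_nbhs_nbhs.
Qed.

Lemma smooth_on_sub V W (A B : set V) (f : V -> W) : A `<=` B ->
  smooth_on B f -> smooth_on A f.
Proof.
move=> AB sf x /AB /sf [U [g [oU Ux Cg fg]]]; exists U, g; split=> // y /AB;
exact: fg.
Qed.

Lemma smooth_on_comp V W Z (A : set V) (B : set W) (f : V -> W) (g : W -> Z) :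
  coordinatized W -> smooth_on A f -> smooth_on B g ->
  (forall x, A x -> B (f x)) -> smooth_on A (fun x => g (f x)).
Proof.
move=> cW sf sg AB x Ax.
have [U [f' [oU Ux Cf ff']]] := sf x Ax.
have [Q [g' [oQ Qfx Cg gg']]] := sg (f x) (AB x Ax).
exists (U `&` f' @^-1` Q), (fun x => g' (f' x)); split.
- exact: open_preimage (Cf 0%N).
- by split=> //=; rewrite -ff'.
- move=> k; apply: (Ck_comp cW _ oQ) (Cg k).
  + exact: open_preimage (Cf 0%N).
  + by move=> y [].
  + by apply: Ck_sub (Cf k) => y [].
- by move=> y Ay [Uy Oy]; rewrite gg'//; [rewrite ff'|exact: AB|rewrite ff'].
Qed.

(** The image of the open set W must be shown to be relatively open in M, which follows
    from the continuity of the inverse of F. *)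
Lemma local_param_comp (S M : set 'rV[R]_3) (F : 'rV[R]_3 -> 'rV[R]_3)
    (U : set 'rV[R]_2) (phi : 'rV[R]_2 -> 'rV[R]_3) :
  diffeomorphism S M F -> local_param S U phi ->
  local_param M U (fun u => F (phi u)).
Proof.
move=> [G [sF sG SF MG]] [oU [W [oW [psi [sphi spsi Uphi Spsi]]]]].
split=> //.
pose W' := [set z | exists B, [/\ open B, B z & forall y, B y -> M y -> W (G y)]].
have oW' : open W'.
  rewrite openE => z [B [oB Bz BW]]; apply: filterS (open_nbhs_nbhs (conj oB Bz)).
  by move=> y By; exists B.
have MW' y : M y -> W (G y) -> W' y.
  move=> My WGy; have [Q [g [oQ Qy Cg Gg]]] := sG y My.
  exists (Q `&` g @^-1` W); split.
  - exact: open_preimage (Cg 0%N).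
  - by split=> //=; rewrite -Gg.
  - by move=> y' [Oy' Wy'] My'; rewrite Gg.
have W'M y : M y -> W' y -> W (G y) by move=> My [B [_ By BW]]; exact: BW.
exists W'; split=> //; exists (fun y => psi (G y)); split.
- apply: (smooth_on_comp (coordinatized_rV R 3) sphi sF) => u /Uphi [[Su _] _] //.
- apply: (smooth_on_comp (coordinatized_rV R 3) _ spsi).
    by apply: smooth_on_sub sG => y [].
  by move=> y [My W'y]; split; [have [] := MG y My|exact: W'M].
- move=> u Uu; have [[Su Wu] psiK] := Uphi u Uu; have [MF GK] := SF _ Su.
  by split; [split=> //; apply: MW' => //; rewrite GK|rewrite GK].
- move=> y [My W'y]; have [SG FK] := MG y My.
  have [|UG phiK] := Spsi (G y); first by split=> //; exact: W'M.
  by split=> //; rewrite phiK.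
Qed.

(** Composing local smooth extensions of X and of phi gives a map that is smooth on an
    open set, including times before 0 when t0 = 0. *)
Lemma local_flow (T : R) (S : set 'rV[R]_3) (X : R -> 'rV[R]_3 -> 'rV[R]_3)
    (U : set 'rV[R]_2) (phi : 'rV[R]_2 -> 'rV[R]_3) (u0 : 'rV[R]_2) (t0 : R) :
  smooth_on [set z : 'rV[R]_3 * R | S z.1 /\ 0 <= z.2 < T] (fun z => X z.2 z.1) ->
  local_param S U phi -> U u0 -> 0 <= t0 < T ->
  exists (O : set ('rV[R]_2 * R)) (Y : 'rV[R]_2 * R -> 'rV[R]_3),
  [/\ open O, O (u0, t0), Cinfty O Y, forall z, O z -> U z.1 &
      forall z, O z -> 0 <= z.2 < T -> X z.2 (phi z.1) = Y z].
Proof.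
move=> sX [oU [W [oW [psi [sphi _ Uphi _]]]]] Uu0 t0T.
have [U1 [p [oU1 U1u0 Cp phip]]] := sphi u0 Uu0.
have [[Su0 _] _] := Uphi u0 Uu0.
have [G0 [G [oG Gu0 CG XG]]] := sX (phi u0, t0) (conj Su0 t0T).
pose O1 : set ('rV[R]_2 * R) := setT `&` fst @^-1` (U `&` U1).
have cfst : continuous (fst : 'rV[R]_2 * R -> 'rV[R]_2) by move=> z; exact: cvg_fst.
have csnd : continuous (snd : 'rV[R]_2 * R -> R) by move=> z; exact: cvg_snd.
have oO1 : open O1.
  apply: open_preimage; [exact: openT|exact: openI|].
  by move=> z _; exact: cfst.
pose Phi (z : 'rV[R]_2 * R) := (p z.1, z.2).
have CPhi k : Ck k O1 Phi.
  apply: Ck_pair => //; last exact: (@Ck_linear _ _ _ _ _ snd).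
  apply: (@Ck_comp _ _ _ _ _ O1 (U `&` U1) fst p) => //.
  - exact: coordinatized_rV.
  - exact: openI.
  - by move=> z [].
  - exact: (@Ck_linear _ _ _ _ _ fst).
  - by apply: Ck_sub (Cp k) => u [].
exists (O1 `&` Phi @^-1` G0), (fun z => G (Phi z)); split.
- exact: open_preimage (CPhi 0%N).
- by split; [|rewrite /Phi/= -phip].
- move=> k; apply: (Ck_comp _ _ oG) (CG k).
  + exact: (coordinatized_prod (coordinatized_rV R 3) (coordinatized_R R)).
  + exact: open_preimage (CPhi 0%N).
  + by move=> z [].
  + by apply: Ck_sub (CPhi k) => z [].
- by move=> z [[_ []]].
- move=> z [[_ [Uz U1z]] Gz] zT; have [[Sz _] _] := Uphi _ Uz.
  have E := XG (phi z.1, z.2) (conj Sz zT); rewrite /= in E.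
  by rewrite E /Phi phip//; rewrite -phip// in Gz *.
Qed.

Lemma derive_slice (W : normedModType R) (Y : 'rV[R]_2 * R -> W) v u t :
  'D_v (fun w => Y (w, t)) u = 'D_(v, 0) Y (u, t).
Proof.
have E : (fun h : R => h^-1 *: (Y (h *: v + u, t) - Y (u, t))) =
         (fun h : R => h^-1 *: (Y (h *: (v, 0) + (u, t)) - Y (u, t))).
  apply/funext => h; congr (_ *: (Y _ - _)).
  by rewrite [RHS](_ : _ = (h *: v + u, h *: 0 + t))// scaler0 add0r.
by rewrite /derive /= E.
Qed.

End Charts.

(** * Fundamental forms of a parametrization *)

Section Forms.
Variable R : realType.

Lemma det2 (A : 'M[R]_2) : \det A = A 0 0 * A 1 1 - A 0 1 * A 1 0.
Proof.
rewrite (expand_det_row _ 0) !big_ord_recr big_ord0 /= add0r /cofactor.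
rewrite !det_mx11 !mxE /= !addn0 !expr0 !expr1 mul1r mulN1r mulrN.
by congr (A _ _ * A _ _ - A _ _ * A _ _); apply/val_inj.
Qed.

(** If g were singular, the convention invmx g = g would give a matrix of
    determinant 0, against a b <> 0. *)
Lemma char_poly_forms (g h : 'M[R]_2) (a b : R) : a * b != 0 ->
  char_poly (invmx g *m h) = ('X - a%:P) * ('X - b%:P) ->
  [/\ \det g != 0,
      (a + b) * \det g = g 1 1 * h 0 0 - g 0 1 * h 1 0 - g 1 0 * h 0 1 + g 0 0 * h 1 1
    & a * b * \det g = \det h].
Proof.
move=> ab0 E; set A := invmx g *m h in E.
have trE : \tr A = a + b.
  apply: oppr_inj; rewrite -[LHS](@char_poly_trace R 2)// E.
  by rewrite mulrBl !(coefB, coefXM, coefCM, coefX, coefC) /=; ring.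
have detE : \det A = a * b.
  have := char_poly_det A; rewrite E mulrBl !(coefB, coefXM, coefCM, coefX, coefC) /=.
  by rewrite sqrrN expr1n mul1r => <-; ring.
have gu : g \in unitmx.
  apply: contraNT ab0 => gnu; rewrite -detE det_mulmx.
  move: gnu; rewrite unitmxE unitfE negbK => /eqP g0.
  by rewrite det_inv g0 invr0 mul0r.
have hE : h = g *m A by rewrite mulKVmx.
have g0 : \det g != 0 by rewrite -unitfE -unitmxE.
have tr2 : \tr A = A 0 0 + A 1 1.
  by rewrite /mxtrace !big_ord_recr big_ord0 /= add0r; congr (A _ _ + A _ _);
    apply/val_inj.
have mE i j : h i j = g i 0 * A 0 j + g i 1 * A 1 j.
  rewrite {1}hE mxE !big_ord_recr big_ord0 /= add0r.
  by congr (g _ _ * A _ _ + g _ _ * A _ _); apply/val_inj.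
split=> //; last by rewrite hE det_mulmx detE mulrC.
by rewrite -trE tr2 det2 !mE; ring.
Qed.

End Forms.

(** * Adapted bases and frames *)

Section Frames.
Variable R : realType.

Lemma dotC n (u v : 'rV[R]_n) : dot u v = dot v u.
Proof. by apply: eq_bigr => i _; rewrite mulrC. Qed.

Lemma dotDl n (u v w : 'rV[R]_n) : dot (u + v) w = dot u w + dot v w.
Proof. by rewrite /dot -big_split; apply: eq_bigr => i _; rewrite mxE mulrDl. Qed.

Lemma dotZl n c (u w : 'rV[R]_n) : dot (c *: u) w = c * dot u w.
Proof. by rewrite /dot mulr_sumr; apply: eq_bigr => i _; rewrite mxE mulrA. Qed.

Lemma dotDr n (u v w : 'rV[R]_n) : dot w (u + v) = dot w u + dot w v.
Proof. by rewrite dotC dotDl !(dotC w). Qed.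

Lemma dotZr n c (u w : 'rV[R]_n) : dot w (c *: u) = c * dot w u.
Proof. by rewrite dotC dotZl (dotC w). Qed.

Lemma dot_mx n (u v : 'rV[R]_n) : dot u v = (u *m v^T) 0 0.
Proof. by rewrite mxE; apply: eq_bigr => i _; rewrite mxE. Qed.

(** The matrices of both forms are transformed by congruence, which multiplies all
    determinants involved by the same factor. *)
Lemma surface_point_basis (p q r s : R) (Y1 Y2 Y11 Y12 Y22 P n : 'rV[R]_3) a b :
  p * s - q * r != 0 -> surface_point Y1 Y2 Y11 Y12 Y22 P n a b ->
  surface_point (p *: Y1 + q *: Y2) (r *: Y1 + s *: Y2)
    (p *: (p *: Y11 + q *: Y12) + q *: (p *: Y12 + q *: Y22))
    (p *: (r *: Y11 + s *: Y12) + q *: (r *: Y12 + s *: Y22))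
    (r *: (r *: Y11 + s *: Y12) + s *: (r *: Y12 + s *: Y22)) P n a b.
Proof.
move=> J0 [nn n1 n2 gr me ga a0 b0 sp].
have E : dot (p *: Y1 + q *: Y2) (p *: Y1 + q *: Y2) *
   dot (r *: Y1 + s *: Y2) (r *: Y1 + s *: Y2) -
   dot (p *: Y1 + q *: Y2) (r *: Y1 + s *: Y2) ^+ 2 =
   (p * s - q * r) ^+ 2 * (dot Y1 Y1 * dot Y2 Y2 - dot Y1 Y2 ^+ 2).
  by rewrite !(dotDl, dotDr, dotZl, dotZr) (dotC Y2 Y1); ring.
split=> //.
- by rewrite dotDr !dotZr n1 n2 !mulr0 addr0.
- by rewrite dotDr !dotZr n1 n2 !mulr0 addr0.
- by rewrite E mulf_neq0// expf_neq0.
- rewrite E mulrCA me !(dotDl, dotDr, dotZl, dotZr) (dotC Y2 Y1); ring.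
- rewrite E mulrCA ga !(dotDl, dotDr, dotZl, dotZr); ring.
Qed.

Lemma dot_rotation n (A : 'M[R]_n) (u v : 'rV[R]_n) : A *m A^T = 1%:M ->
  dot (u *m A) (v *m A) = dot u v.
Proof. by move=> AA; rewrite !dot_mx trmx_mul mulmxA -(mulmxA u) AA mulmx1. Qed.

Lemma surface_point_rotation (A : 'M[R]_3) (Y1 Y2 Y11 Y12 Y22 P n : 'rV[R]_3) a b :
  A *m A^T = 1%:M -> surface_point Y1 Y2 Y11 Y12 Y22 P n a b ->
  surface_point (Y1 *m A) (Y2 *m A) (Y11 *m A) (Y12 *m A) (Y22 *m A) (P *m A)
    (n *m A) a b.
Proof.
move=> AA [nn n1 n2 gr me ga a0 b0 sp].
by split=> //; rewrite ?dot_rotation// sp mulNmx scalemxAl.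
Qed.

Lemma orthonormal_frame (f : 'I_3 -> 'rV[R]_3) :
  (forall i j, dot (f i) (f j) = (i == j)%:R) ->
  exists A : 'M[R]_3, [/\ A *m A^T = 1%:M, forall i, f i *m A = frame R i &
    forall u i, (u *m A) 0 i = dot u (f i)].
Proof.
move=> ff; pose B : 'M[R]_3 := \matrix_i f i.
have uB u i : (u *m B^T) 0 i = dot u (f i).
  by rewrite mxE; apply: eq_bigr => k _; rewrite !mxE.
have BB : B *m B^T = 1%:M.
  apply/matrixP => i j; rewrite mxE (eq_bigr (fun k => f i 0 k * f j 0 k)).
    by rewrite -/(dot (f i) (f j)) ff mxE.
  by move=> k _; rewrite !mxE.
exists B^T; split=> //.
  by rewrite trmxK; exact: mulmx1C.
move=> i; apply/rowP => j; rewrite uB ff /frame !mxE eqxx eq_sym.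
by [].
Qed.

(** The number a is an eigenvalue, since the second form minus a times the metric has
    determinant 0.  An eigenvector is normalized and completed by its orthogonal
    complement, both with respect to the metric. *)
Lemma diagonalize (Y1 Y2 Y11 Y12 Y22 P n : 'rV[R]_3) a b :
  surface_point Y1 Y2 Y11 Y12 Y22 P n a b ->
  exists p q r s, [/\ p * s - q * r != 0,
   dot (p *: Y1 + q *: Y2) (p *: Y1 + q *: Y2) = 1,
   dot (p *: Y1 + q *: Y2) (r *: Y1 + s *: Y2) = 0,
   dot (r *: Y1 + s *: Y2) (r *: Y1 + s *: Y2) = 1 &
   dot (p *: (r *: Y11 + s *: Y12) + q *: (r *: Y12 + s *: Y22)) n = 0 /\
   dot (p *: (p *: Y11 + q *: Y12) + q *: (p *: Y12 + q *: Y22)) n = - a].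
Proof.
move=> [nn n1 n2 gr me ga a0 b0 sp].
have D0 := triple_sqr nn n1 n2.
set E := dot Y1 Y1 in gr me ga D0; set F := dot Y1 Y2 in gr me ga D0.
set G := dot Y2 Y2 in gr me ga D0.
set L := dot Y11 n in me ga; set M := dot Y12 n in me ga; set N := dot Y22 n in me ga.
have sq (u : 'rV[R]_3) : 0 <= dot u u.
  by apply: sumr_ge0 => i _; rewrite -expr2 sqr_ge0.
have D1 : 0 < E * G - F ^+ 2 by rewrite lt_neqAle eq_sym gr -D0 sqr_ge0.
have E1 : 0 < E.
  rewrite lt_neqAle sq andbT eq_sym; apply: contraTneq D1 => ->.
  by rewrite mul0r sub0r -leNgt oppr_le0 sqr_ge0.
have [p0 [q0 [pq Ep Eq]]] : exists p0 q0, [/\ (p0 != 0) || (q0 != 0),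
   (L + a * E) * p0 + (M + a * F) * q0 = 0 &
   (M + a * F) * p0 + (N + a * G) * q0 = 0].
  have dt : (L + a * E) * (N + a * G) = (M + a * F) * (M + a * F).
    transitivity ((M + a * F) * (M + a * F) + ((L * N - M ^+ 2)
      - a * - (G * L - 2 * F * M + E * N) + a ^+ 2 * (E * G - F ^+ 2))); first by ring.
    by rewrite -me -ga; ring.
  have [l0|l0] := eqVneq (L + a * E) 0.
    exists 1, 0; rewrite oner_neq0 !(mulr0, mulr1, addr0) l0; split=> //.
    by move/eqP: dt; rewrite l0 mul0r eq_sym mulf_eq0 orbb => /eqP.
  exists (- (M + a * F)), (L + a * E); rewrite l0 orbT; split=> //; first by ring.
  by rewrite mulrN -dt; ring.
pose Q := E * p0 ^+ 2 + 2 * F * p0 * q0 + G * q0 ^+ 2.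
have Q0 : 0 < Q.
  have : 0 < E * Q.
    have -> : E * Q = (E * p0 + F * q0) ^+ 2 + (E * G - F ^+ 2) * q0 ^+ 2.
      by rewrite /Q; ring.
    have [q00|q00] := eqVneq q0 0.
      move: pq; rewrite q00 eqxx orbF !(mulr0, addr0) expr0n /= mulr0 addr0 => p00.
      by rewrite exprn_even_gt0//= mulf_neq0// gt_eqF.
    by rewrite ltr_wpDl ?sqr_ge0// mulr_gt0// exprn_even_gt0.
  by rewrite pmulr_rgt0.
pose u := Num.sqrt Q; pose v := Num.sqrt (E * G - F ^+ 2).
have u2 : u ^+ 2 = Q by rewrite sqr_sqrtr// ltW.
have v2 : v ^+ 2 = E * G - F ^+ 2 by rewrite sqr_sqrtr// ltW.
have u0 : u != 0 by rewrite gt_eqF// sqrtr_gt0.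
have v0 : v != 0 by rewrite gt_eqF// sqrtr_gt0.
exists (p0 / u), (q0 / u), (- (F * p0 + G * q0) / (u * v)), ((E * p0 + F * q0) / (u * v)).
rewrite !(dotDl, dotDr, dotZl, dotZr) (dotC Y2 Y1) -/E -/F -/G -/L -/M -/N.
split.
- rewrite (_ : _ - _ = Q / (u ^+ 2 * v)); last by rewrite /Q; field; rewrite u0 v0.
  by apply: mulf_neq0; rewrite ?invr_eq0 ?mulf_neq0 ?expf_neq0// gt_eqF.
- rewrite [LHS](_ : _ = Q / u ^+ 2); last by rewrite /Q; field.
  by rewrite u2 divff// gt_eqF.
- by field; rewrite u0 v0.
- rewrite [LHS](_ : _ = Q * (E * G - F ^+ 2) / (u ^+ 2 * v ^+ 2)).
    by rewrite u2 v2 divff// gt_eqF// mulr_gt0.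
  by rewrite /Q; field; rewrite u0 v0.
- split.
    transitivity ((- (F * p0 + G * q0) * ((L + a * E) * p0 + (M + a * F) * q0) +
       (E * p0 + F * q0) * ((M + a * F) * p0 + (N + a * G) * q0)) / (u ^+ 2 * v)).
      by field; rewrite u0 v0.
    by rewrite Ep Eq !mulr0 addr0 mul0r.
  transitivity ((p0 * ((L + a * E) * p0 + (M + a * F) * q0) +
     q0 * ((M + a * F) * p0 + (N + a * G) * q0)) / u ^+ 2 - a * (Q / u ^+ 2)).
    by rewrite /Q; field.
  by rewrite Ep Eq !mulr0 addr0 mul0r u2 divff ?gt_eqF// sub0r mulr1.
Qed.

End Frames.

(** * One-sided time derivatives *)

Section Time.
Variable R : realType.

Lemma within_dnbhs_proper (T t : R) : 0 <= t < T ->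
  ProperFilter (within [set s : R | 0 <= s < T] t^').
Proof.
move=> /andP[t0 tT]; apply: Build_ProperFilter_ex => P.
rewrite /within /dnbhs /= => /nbhs_ballP[e /= e0 H].
pose m := Num.min (e / 2) ((T - t) / 2).
have m0 : 0 < m by rewrite lt_min !divr_gt0// subr_gt0.
have me : m <= e / 2 by rewrite ge_min lexx.
have mT : m <= (T - t) / 2 by rewrite ge_min lexx orbT.
exists (t + m); apply: (H (t + m)).
- by rewrite /ball /= opprD addrA subrr sub0r normrN gtr0_norm//; lra.
- by rewrite /= gt_eqF// ltrDl.
- by apply/andP; split; lra.
Qed.

(** At t = 0 the flow prescribes only the one-sided derivative, but that of the smooth
    extension is two-sided and must agree with it. *)
Lemma derive_time (T t : R) (W : normedModType R) (Y : 'rV[R]_2 * R -> W)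
    (O : set ('rV[R]_2 * R)) (f : R -> W) u v :
  open O -> O (u, t) -> differentiable Y (u, t) -> 0 <= t < T ->
  (forall s, O (u, s) -> 0 <= s < T -> f s = Y (u, s)) ->
  has_derivative_within [set s | 0 <= s < T] f t v ->
  'D_(0, 1) Y (u, t) = v.
Proof.
move=> oO Out dY tT fY fv.
have PF := within_dnbhs_proper tT.
have dYv : derivable Y (u, t) (0, 1) by exact: diff_derivable.
set F := within _ _ in PF.
have cs : (fun s : R => s - t) @ F --> (0 : R)^'.
  move=> P /=; rewrite /F /within /dnbhs /= => P0.
  have : \forall s \near t, s - t != 0 -> P (s - t).
    have c : (fun s : R => s - t) @ t --> (0 : R).
      have : s - t @[s --> t] --> t - t by apply: cvgB; [exact: cvg_id|exact: cvg_cst].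
      by rewrite subrr.
    exact: (c _ P0).
  by apply: filterS => s H st _; apply: H; rewrite subr_eq0.
have c1 : (fun s : R => (s - t)^-1 *: (Y ((s - t) *: (0, 1) + (u, t)) - Y (u, t))) @ F
    --> 'D_(0, 1) Y (u, t) by exact: (cvg_comp _ _ cs dYv).
have c2 : (fun s : R => (s - t)^-1 *: (Y ((s - t) *: (0, 1) + (u, t)) - Y (u, t))) @ F
    --> v; last exact: (cvg_unique _ c1 c2).
apply: cvg_trans fv; apply: near_eq_cvg.
have cu : {for t, continuous (fun s : R => (u, s) : 'rV[R]_2 * R)}.
  apply: (@cvg_pair _ _ _ (nbhs t) (nbhs u) (nbhs t)); [exact: cvg_cst|exact: cvg_id].
have nO : \forall s \near t, O (u, s) by exact: (cu _ (open_nbhs_nbhs (conj oO Out))).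
rewrite /F /within /dnbhs /=; apply: filterS nO => s Ous _ sT.
rewrite (fY _ Out tT) (fY _ Ous sT); congr (_ *: (Y _ - _)).
by rewrite [RHS](_ : _ = ((s - t) *: 0 + u, (s - t) * 1 + t))// scaler0 add0r mulr1 subrK.
Qed.

End Time.

Section FormsPoint.
Variable R : realType.

Lemma surface_point_forms (A1 A2 A11 A12 A22 P n : 'rV[R]_3) (a b : R) :
  dot n n = 1 -> dot n A1 = 0 -> dot n A2 = 0 ->
  dot A1 A1 * dot A2 A2 - dot A1 A2 * dot A2 A1 != 0 ->
  (a + b) * (dot A1 A1 * dot A2 A2 - dot A1 A2 * dot A2 A1) =
    dot A2 A2 * - dot A11 n - dot A1 A2 * - dot A12 n - dot A2 A1 * - dot A12 n
    + dot A1 A1 * - dot A22 n ->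
  a * b * (dot A1 A1 * dot A2 A2 - dot A1 A2 * dot A2 A1) =
    - dot A11 n * - dot A22 n - - dot A12 n * - dot A12 n ->
  0 < a -> 0 < b -> P = - (normA2 a b ^+ 2 *: n) ->
  surface_point A1 A2 A11 A12 A22 P n a b.
Proof.
rewrite (dotC A2 A1) -expr2 => nn n1 n2 g0 me ga a0 b0 sp.
by split=> //; [rewrite me|rewrite ga]; ring.
Qed.

Lemma curvature_forms (f : 'rV[R]_2 -> 'rV[R]_3) (n : 'rV[R]_3) u
    (A1 A2 A11 A21 A12 A22 : 'rV[R]_3) (a b : R) :
  'D_('e_0) f u = A1 -> 'D_('e_1) f u = A2 ->
  'D_('e_0) (fun w => 'D_('e_0) f w) u = A11 ->
  'D_('e_1) (fun w => 'D_('e_0) f w) u = A21 ->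
  'D_('e_0) (fun w => 'D_('e_1) f w) u = A12 ->
  'D_('e_1) (fun w => 'D_('e_1) f w) u = A22 -> a * b != 0 ->
  char_poly (invmx (first_form f u) *m second_form f n u)
    = ('X - a%:P) * ('X - b%:P) ->
  [/\ dot A1 A1 * dot A2 A2 - dot A1 A2 * dot A2 A1 != 0,
      (a + b) * (dot A1 A1 * dot A2 A2 - dot A1 A2 * dot A2 A1) =
        dot A2 A2 * - dot A11 n - dot A1 A2 * - dot A21 n - dot A2 A1 * - dot A12 n
        + dot A1 A1 * - dot A22 n
    & a * b * (dot A1 A1 * dot A2 A2 - dot A1 A2 * dot A2 A1) =
        - dot A11 n * - dot A22 n - - dot A12 n * - dot A21 n].
Proof.
move=> <- <- <- <- <- <- ab0 ch; have := char_poly_forms ab0 ch.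
by rewrite !det2 !mxE.
Qed.

End FormsPoint.

Section AdaptedFrame.
Variable R : realType.

Lemma orthonormal_frame3 (f0 f1 f2 : 'rV[R]_3) :
  dot f0 f0 = 1 -> dot f1 f1 = 1 -> dot f2 f2 = 1 ->
  dot f0 f1 = 0 -> dot f2 f0 = 0 -> dot f2 f1 = 0 ->
  exists A : 'M[R]_3, [/\ A *m A^T = 1%:M, f0 *m A = frame R o0,
    f1 *m A = frame R o1, f2 *m A = frame R o2 &
    forall u, (u *m A) 0 o2 = dot u f2].
Proof.
move=> g00 g11 g22 g01 g20 g21.
pose f (i : 'I_3) := if i == o0 then f0 else if i == o1 then f1 else f2.
have ff i j : dot (f i) (f j) = (i == j)%:R.
  by move: i j; apply: ord3P; apply: ord3P; rewrite /f /= ?(dotC f1 f0) ?(dotC f0 f2)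
    ?(dotC f1 f2) ?g00 ?g11 ?g22 ?g01 ?g20 ?g21.
have [A [AA fA uA]] := orthonormal_frame ff.
by exists A; split=> [||||u];
  first [exact: AA|exact: uA|exact: (fA o0)|exact: (fA o1)|exact: (fA o2)].
Qed.

Lemma second_curvature (Y1 Y2 Y11 Y12 Y22 P n : 'rV[R]_3) a b :
  surface_point Y1 Y2 Y11 Y12 Y22 P n a b -> dot Y1 Y1 = 1 -> dot Y1 Y2 = 0 ->
  dot Y2 Y2 = 1 -> dot Y11 n = - a -> dot Y22 n = - b.
Proof.
by move=> [_ _ _ _ me _ _ _ _] g11 g12 g22 L11; move: me; rewrite g11 g12 g22 L11; lra.
Qed.

End AdaptedFrame.

(** * Change of parameter directions *)

Section Directions.
Variables (R : realType) (V : normedModType R) (O : set V).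
Hypothesis oO : open O.
Implicit Types (Y : V -> 'rV[R]_3).

Lemma derive_lincomb Y z (e1 e2 : V) (p q : R) : differentiable Y z ->
  'D_(p *: e1 + q *: e2) Y z = p *: 'D_e1 Y z + q *: 'D_e2 Y z.
Proof. by move=> dY; rewrite !deriveE// linearD !linearZ. Qed.

Lemma lincomb_derive (f g : V -> 'rV[R]_3) z v (r s : R) :
  differentiable f z -> differentiable g z ->
  'D_v (fun y => r *: f y + s *: g y) z = r *: 'D_v f z + s *: 'D_v g z.
Proof.
move=> df dg; have [df' dg'] : derivable f z v /\ derivable g z v.
  by split; exact: diff_derivable.
rewrite (_ : (fun y => _) = (r \*: f) + (s \*: g))//.
rewrite deriveD; [|exact: derivableZ|exact: derivableZ].
by rewrite !deriveZ.
Qed.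

Lemma derive2_lincomb Y z e1 e2 v (r s : R) : Ck 2 O Y -> O z ->
  'D_v (fun y => 'D_(r *: e1 + s *: e2) Y y) z =
  r *: 'D_v (fun y => 'D_e1 Y y) z + s *: 'D_v (fun y => 'D_e2 Y y) z.
Proof.
move=> [dY DY] Oz.
have [dY1 _] := DY e1; have [dY2 _] := DY e2.
rewrite -lincomb_derive; [|exact: dY1|exact: dY2].
apply: (derive_congr oO) => // y Oy; apply: derive_lincomb; exact: dY.
Qed.

Lemma derive2_basis Y z (e1 e2 : V) (x y x' y' : R) : Ck 2 O Y -> O z ->
  'D_(x *: e1 + y *: e2) (fun y0 => 'D_(x' *: e1 + y' *: e2) Y y0) z =
  x *: (x' *: 'D_e1 (fun y => 'D_e1 Y y) z + y' *: 'D_e1 (fun y => 'D_e2 Y y) z) +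
  y *: (x' *: 'D_e1 (fun y => 'D_e2 Y y) z + y' *: 'D_e2 (fun y => 'D_e2 Y y) z).
Proof.
move=> CY Oz; have [dY DY] := CY.
have s12 : 'D_e2 (fun y => 'D_e1 Y y) z = 'D_e1 (fun y => 'D_e2 Y y) z.
  exact: (derive_comm_rV oO).
have dv : differentiable (fun y0 => 'D_(x' *: e1 + y' *: e2) Y y0) z.
  by have [dv _] := DY (x' *: e1 + y' *: e2); exact: dv.
apply: (etrans (derive_lincomb e1 e2 x y dv)); congr (_ *: _ + _ *: _).
  exact: (derive2_lincomb e1 e2 e1 x' y' CY Oz).
apply: (etrans (derive2_lincomb e1 e2 e2 x' y' CY Oz)).
exact: (congr1 (fun u => x' *: u + y' *: _) s12).
Qed.

Lemma surface_point_directions Y z (e1 e2 : V) (p q r s : R) P n a b :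
  Ck 2 O Y -> O z -> p * s - q * r != 0 ->
  surface_point ('D_e1 Y z) ('D_e2 Y z) ('D_e1 (fun y => 'D_e1 Y y) z)
    ('D_e1 (fun y => 'D_e2 Y y) z) ('D_e2 (fun y => 'D_e2 Y y) z) P n a b ->
  let e1' := p *: e1 + q *: e2 in let e2' := r *: e1 + s *: e2 in
  surface_point ('D_e1' Y z) ('D_e2' Y z) ('D_e1' (fun y => 'D_e1' Y y) z)
    ('D_e1' (fun y => 'D_e2' Y y) z) ('D_e2' (fun y => 'D_e2' Y y) z) P n a b.
Proof.
move=> CY Oz J sp e1' e2'; have [dY _] := CY.
have H (A1 A2 A11 A12 A22 B1 B2 B11 B12 B22 : 'rV[R]_3) :
  A1 = B1 -> A2 = B2 -> A11 = B11 -> A12 = B12 -> A22 = B22 ->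
  surface_point B1 B2 B11 B12 B22 P n a b -> surface_point A1 A2 A11 A12 A22 P n a b.
  by move=> -> -> -> -> ->.
apply: (H _ _ _ _ _ _ _ _ _ _ (derive_lincomb e1 e2 p q (dY z Oz))
  (derive_lincomb e1 e2 r s (dY z Oz)) (derive2_basis e1 e2 p q p q CY Oz)
  (derive2_basis e1 e2 p q r s CY Oz) (derive2_basis e1 e2 r s r s CY Oz)).
exact: surface_point_basis.
Qed.

Lemma continuous_mulmxr n m (A : 'M[R]_(n, m)) :
  continuous (fun u : 'rV[R]_n => u *m A).
Proof.
have C : Ck 0 setT (fun u : 'rV[R]_n => u *m A).
  apply: (Ck_eq openT) (_ : Ck 0 setT (fun u : 'rV[R]_n => \sum_i u 0 i *: row i A)).
    by move=> u _; rewrite mulmx_sum_row.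
  apply: Ck_sum; first exact: openT.
  move=> i; apply: Ck_scale; [exact: openT| |exact: Ck_cst].
  by move=> u _; exact: coord_continuous.
by move=> u; exact: C.
Qed.

Lemma Ck_mulmxr k (A : 'M[R]_3) Y : Ck k O Y -> Ck k O (fun z => Y z *m A).
Proof.
exact: (@Ck_linear_post _ _ _ _ _ _ (mulmxr A) _ oO (@continuous_mulmxr _ _ A)).
Qed.

Lemma derive_mulmxr (A : 'M[R]_3) Y z v : differentiable Y z ->
  'D_v (fun y => Y y *m A) z = 'D_v Y z *m A.
Proof.
move=> dY.
by have [_ ->] := @diff_linear_post _ _ _ _ (mulmxr A) Y z v
  (@continuous_mulmxr _ _ A) dY.
Qed.

Lemma derive2_mulmxr (A : 'M[R]_3) Y z v v' : Ck 2 O Y -> O z ->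
  'D_v' (fun x => 'D_v (fun y => Y y *m A) x) z = 'D_v' (fun x => 'D_v Y x) z *m A.
Proof.
move=> [dY DY] Oz; rewrite -derive_mulmxr; last by have [dv _] := DY v; exact: dv.
by apply: (derive_congr oO) => // x Ox; apply: derive_mulmxr; exact: dY.
Qed.

End Directions.

(** * The flow *)

Section WithinCalculus.
Variables (R : realType) (V : topologicalType) (D : set V) (z : V).
Hypothesis Dz : D z.

Lemma within_calculus : calculus (within D (nbhs z)) z
  (fun f : V -> R => f @ within D (nbhs z) --> f z).
Proof.
split.
- by move=> k; exact: cvg_cst.
- by move=> f g cf cg; exact: cvgD.
- by move=> f cf; exact: cvgN.
- by move=> f g cf cg; exact: cvgM.
- by move=> f f0 cf; exact: cvgV.
- move=> f g fg; have fgz : f z = g z.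
    exact: (nbhs_singleton fg Dz).
  rewrite fgz; apply: cvg_trans; apply: near_eq_cvg.
  exact: filterS fg.
Qed.
End WithinCalculus.

Section Flow.
Variables (R : realType) (T : R) (M : R -> set 'rV[R]_3) (S : set 'rV[R]_3).
Variables (X nu : R -> 'rV[R]_3 -> 'rV[R]_3) (l1 l2 : R -> 'rV[R]_3 -> R).
Hypothesis hX : forall t, 0 <= t < T -> diffeomorphism S (M t) (X t).
Hypothesis hXsmooth : smooth_on [set z : 'rV[R]_3 * R | S z.1 /\ 0 <= z.2 < T]
                          (fun z => X z.2 z.1).
Hypothesis hnu : forall t, 0 <= t < T -> forall p, M t p ->
       outer_unit_normal (M t) p (nu t p).
Hypothesis hl : forall t, 0 <= t < T -> forall p, M t p ->
       principal_curvatures (M t) (nu t p) p (l1 t p) (l2 t p).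
Hypothesis hconvex : forall t, 0 <= t < T -> forall p, M t p ->
       0 < l1 t p /\ 0 < l2 t p.
Hypothesis hflow : forall t, 0 <= t < T -> forall x, S x ->
       has_derivative_within [set s | 0 <= s < T] (fun s => X s x) t
         (- ((normA2 (l1 t (X t x)) (l2 t (X t x))) ^+ 2 *: nu t (X t x))).

Let w t x := pinching (l1 t (X t x)) (l2 t (X t x)).
Definition flow_point (phi : 'rV[R]_2 -> 'rV[R]_3) (Y : 'rV[R]_2 * R -> 'rV[R]_3)
    (v1 v2 : 'rV[R]_2) (z : 'rV[R]_2 * R) :=
  surface_point ('D_(v1, 0) Y z) ('D_(v2, 0) Y z)
    ('D_(v1, 0) (fun z => 'D_(v1, 0) Y z) z) ('D_(v1, 0) (fun z => 'D_(v2, 0) Y z) z)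
    ('D_(v2, 0) (fun z => 'D_(v2, 0) Y z) z) ('D_(0, 1) Y z)
    (nu z.2 (X z.2 (phi z.1)))
    (l1 z.2 (X z.2 (phi z.1))) (l2 z.2 (X z.2 (phi z.1))).

(** The parametrization phi of S, transported by the flow, is a parametrization of each
    M t, to which the hypotheses on normals and principal curvatures apply. *)
Lemma chart_flow_point (phi : 'rV[R]_2 -> 'rV[R]_3) (U : set 'rV[R]_2)
    (O : set ('rV[R]_2 * R)) (Y : 'rV[R]_2 * R -> 'rV[R]_3) :
  local_param S U phi -> open O -> Cinfty O Y -> (forall z, O z -> U z.1) ->
  (forall z, O z -> 0 <= z.2 < T -> X z.2 (phi z.1) = Y z) ->
  forall z, O z -> 0 <= z.2 < T -> flow_point phi Y ('e_0) ('e_1) z.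
Proof.
move=> lp oO CY OU XY [u t] Oz /= tT.
have [oU [W0 [_ [psi [_ _ Uphi _]]]]] := lp.
have Uu := OU _ Oz; have [[Sx _] _] := Uphi u Uu.
have hXt := hX tT; have [chi [_ _ SM _]] := hXt.
have [Mp _] := SM _ Sx; have lpM := local_param_comp hXt lp.
pose f w' := X t (phi w').
have cu : {for u, continuous (fun w' => (w', t) : 'rV[R]_2 * R)}.
  apply: (@cvg_pair _ _ _ (nbhs u) (nbhs u) (nbhs t)); [exact: cvg_id|exact: cvg_cst].
have nO : \forall w' \near u, O (w', t).
  exact: (cu _ (open_nbhs_nbhs (conj oO Oz))).
have D1 v w' : O (w', t) -> 'D_v f w' = 'D_(v, 0) Y (w', t).
  move=> Ow; rewrite -derive_slice; apply: near_eq_derive.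
  have cw : {for w', continuous (fun w' => (w', t) : 'rV[R]_2 * R)}.
    apply: (@cvg_pair _ _ _ (nbhs w') (nbhs w') (nbhs t)); [exact: cvg_id|exact: cvg_cst].
  have nw : \forall w1 \near w', O (w1, t).
    exact: (cw _ (open_nbhs_nbhs (conj oO Ow))).
  by apply: filterS nw => w1 Ow1; exact: (XY (w1, t)).
have D2 v v' : 'D_v (fun w' => 'D_v' f w') u = 'D_(v, 0) (fun z => 'D_(v', 0) Y z) (u, t).
  rewrite -derive_slice; apply: near_eq_derive.
  by apply: filterS nO => w' Ow; exact: D1.
have [l10 l20] := hconvex tT Mp.
have [nn north _] := hnu tT Mp.
have ch : char_poly (invmx (first_form f u) *m second_form f (nu t (f u)) u) =
    ('X - (l1 t (f u))%:P) * ('X - (l2 t (f u))%:P) by exact: (hl tT Mp lpM Uu erefl).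
have E0 := D1 'e_0 u Oz; have E1 := D1 'e_1 u Oz.
have n1 : dot (nu t (f u)) ('D_('e_0, 0) Y (u, t)) = 0.
  by rewrite -E0; exact: (north _ _ _ lpM Uu erefl).
have n2 : dot (nu t (f u)) ('D_('e_1, 0) Y (u, t)) = 0.
  by rewrite -E1; exact: (north _ _ _ lpM Uu erefl).
have sp : 'D_(0, 1) Y (u, t) = - (normA2 (l1 t (f u)) (l2 t (f u)) ^+ 2 *: nu t (f u)).
  apply: (derive_time oO Oz _ tT _ (hflow tT Sx)).
    by have [dY _] := CY 1%N; exact: dY.
  by move=> s Os sT; exact: (XY (u, s)).
have s12 : 'D_('e_1, 0) (fun z => 'D_('e_0, 0) Y z) (u, t) =
    'D_('e_0, 0) (fun z => 'D_('e_1, 0) Y z) (u, t).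
  exact: (derive_comm_rV oO _ _ (CY 2%N)).
have E00 := D2 'e_0 'e_0; have E01 := D2 'e_0 'e_1; have E11 := D2 'e_1 'e_1.
have E10 := D2 'e_1 'e_0; rewrite s12 in E10.
have [g0 me ga] := curvature_forms E0 E1 E00 E10 E01 E11
  (lt0r_neq0 (mulr_gt0 l10 l20)) ch.
exact: (surface_point_forms nn n1 n2 g0 me ga l10 l20 sp).
Qed.

(** After adapting the parameter directions and the frame of space at the point, the
    statement is that of [pinching_core]. *)
Lemma interior_decrease (phi : 'rV[R]_2 -> 'rV[R]_3) (U : set 'rV[R]_2) u0 t0 :
  local_param S U phi -> U u0 -> 0 < t0 < T ->
  (forall x, S x -> w t0 x <= w t0 (phi u0)) ->
  l1 t0 (X t0 (phi u0)) != l2 t0 (X t0 (phi u0)) ->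
  exists c, jet (fun s => w (t0 + s) (phi u0)) c /\ c.1.2 <= 0.
Proof.
move=> lp Uu0 /andP[t00 t0T] wmax lneq.
have t0I : 0 <= t0 < T by rewrite ltW.
have [Q0 [Y [oO0 O0z CY0 OU0 XY0]]] := local_flow hXsmooth lp Uu0 t0I.
pose O := Q0 `&` snd @^-1` [set t : R | 0 < t < T].
have csnd : continuous (snd : 'rV[R]_2 * R -> R) by move=> z; exact: cvg_snd.
have oI : open [set t : R | 0 < t < T].
  rewrite (_ : [set t : R | _] = [set t | 0 < t] `&` [set t | t < T]).
    by apply: openI; [exact: open_gt|exact: open_lt].
  by apply/seteqP; split=> t /=; [move=> /andP[]|move=> [-> ->]].
have csnd0 : Ck 0 Q0 (snd : 'rV[R]_2 * R -> R) by move=> z _; exact: csnd.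
have oO : open O := open_preimage oO0 oI csnd0.
have Oz : O (u0, t0) by split=> //=; rewrite t00.
have CY k : Ck k O Y by apply: Ck_sub (CY0 k) => z [].
have OI z : O z -> 0 <= z.2 < T by move=> [_ /= /andP[z0 ->]]; rewrite ltW.
have fp z : O z -> flow_point phi Y 'e_0 'e_1 z.
  move=> Ozz; apply: (chart_flow_point lp oO0 CY0 OU0 XY0).
    by case: Ozz.
  exact: OI.
pose n z := nu z.2 (X z.2 (phi z.1)).
pose la z := l1 z.2 (X z.2 (phi z.1)).
pose lb z := l2 z.2 (X z.2 (phi z.1)).
pose E0 : 'rV[R]_2 * R := ('e_0, 0); pose E1 : 'rV[R]_2 * R := ('e_1, 0).
have fp0 := fp _ Oz.
have [p [q [r [s [J g11 g12 g22 [M12 L11]]]]]] := diagonalize fp0.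
pose e1 := p *: E0 + q *: E1; pose e2 := r *: E0 + s *: E1.
have sp z : O z -> surface_point ('D_e1 Y z) ('D_e2 Y z) ('D_e1 (fun y => 'D_e1 Y y) z)
    ('D_e1 (fun y => 'D_e2 Y y) z) ('D_e2 (fun y => 'D_e2 Y y) z) ('D_(0, 1) Y z)
    (n z) (la z) (lb z).
  by move=> Ozz; apply: (surface_point_directions oO (CY 2%N) Ozz J); exact: fp.
have sp0 := sp _ Oz.
have [dY _] := CY 1%N; have dYz := dY _ Oz.
rewrite -(derive_lincomb E0 E1 p q dYz) -(derive_lincomb E0 E1 r s dYz) in g11 g12 g22.
rewrite -(derive2_basis oO E0 E1 p q r s (CY 2%N) Oz) in M12.
rewrite -(derive2_basis oO E0 E1 p q p q (CY 2%N) Oz) in L11.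
rewrite -/e1 -/e2 in g11 g12 g22 M12 L11.
have N22 := second_curvature sp0 g11 g12 g22 L11.
have [A [AA fA1 fA2 fA3 uA]] := orthonormal_frame3 g11 g22 (sp_unit sp0) g12
  (sp_orth1 sp0) (sp_orth2 sp0).
pose y z := Y z *m A.
have Cy : Ck 6 O y by exact: Ck_mulmxr.
have Dy v z : O z -> 'D_v y z = 'D_v Y z *m A.
  by move=> Ozz; apply: derive_mulmxr; exact: dY.
have D2y v v' z : O z ->
    'D_v' (fun x => 'D_v y x) z = 'D_v' (fun x => 'D_v Y x) z *m A.
  by move=> Ozz; exact: (derive2_mulmxr oO).
have geo z : O z -> surface_point ('D_e1 y z) ('D_e2 y z) ('D_e1 (fun x => 'D_e1 y x) z)
    ('D_e1 (fun x => 'D_e2 y x) z) ('D_e2 (fun x => 'D_e2 y x) z) ('D_(0, 1) y z)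
    (n z *m A) (la z) (lb z).
  move=> Ozz.
  have H (A1 A2 A11 A12 A22 P B1 B2 B11 B12 B22 Q : 'rV[R]_3) :
    A1 = B1 -> A2 = B2 -> A11 = B11 -> A12 = B12 -> A22 = B22 -> P = Q ->
    surface_point B1 B2 B11 B12 B22 Q (n z *m A) (la z) (lb z) ->
    surface_point A1 A2 A11 A12 A22 P (n z *m A) (la z) (lb z).
    by move=> -> -> -> -> -> ->.
  apply: (H _ _ _ _ _ _ _ _ _ _ _ _ (Dy e1 z Ozz) (Dy e2 z Ozz) (D2y e1 e1 z Ozz)
    (D2y e2 e1 z Ozz) (D2y e2 e2 z Ozz) (Dy (0, 1) z Ozz)).
  by apply: surface_point_rotation; [exact: AA|exact: sp].
have fr1 : 'D_e1 y (u0, t0) = frame R o0 by exact: (etrans (Dy e1 _ Oz) fA1).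
have fr2 : 'D_e2 y (u0, t0) = frame R o1 by exact: (etrans (Dy e2 _ Oz) fA2).
have fr3 : n (u0, t0) *m A = frame R o2 := fA3.
have B11 : ('D_e1 (fun x => 'D_e1 y x) (u0, t0)) 0 o2 = - la (u0, t0).
  exact: (etrans (congr1 (fun u : 'rV_3 => u 0 o2) (D2y e1 e1 _ Oz)) (etrans (uA _) L11)).
have B12 : ('D_e1 (fun x => 'D_e2 y x) (u0, t0)) 0 o2 = 0.
  exact: (etrans (congr1 (fun u : 'rV_3 => u 0 o2) (D2y e2 e1 _ Oz)) (etrans (uA _) M12)).
have B22 : ('D_e2 (fun x => 'D_e2 y x) (u0, t0)) 0 o2 = - lb (u0, t0).
  exact: (etrans (congr1 (fun u : 'rV_3 => u 0 o2) (D2y e2 e2 _ Oz)) (etrans (uA _) N22)).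
have [_ [W0 [_ [psi [_ _ Uphi _]]]]] := lp.
have spatial v : \forall h \near (0 : R),
    pinching (la ((u0, t0) + h *: (v, 0))) (lb ((u0, t0) + h *: (v, 0))) <=
    pinching (la (u0, t0)) (lb (u0, t0)).
  have H := @line_near _ _ _ oO (u0, t0) (v, 0) O Oz (fun z Ozz => Ozz).
  apply: filterS H => h Oh.
  have E : (u0, t0) + h *: (v, 0) = (u0 + h *: v, t0) :> 'rV[R]_2 * R.
    by rewrite [LHS](_ : _ = (u0 + h *: v, t0 + h *: 0))// scaler0 addr0.
  rewrite E in Oh *; apply: wmax.
  by have [/OU0 /= /Uphi [[]]] := Oh.
have max1 : \forall h \near (0 : R),
    pinching (la ((u0, t0) + h *: e1)) (lb ((u0, t0) + h *: e1)) <=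
    pinching (la (u0, t0)) (lb (u0, t0)).
  have -> : e1 = (p *: 'e_0 + q *: 'e_1, 0).
    by rewrite [LHS](_ : _ = (p *: 'e_0 + q *: 'e_1, p *: 0 + q *: 0))// !scaler0 addr0.
  exact: spatial.
have max2 : \forall h \near (0 : R),
    pinching (la ((u0, t0) + h *: e2)) (lb ((u0, t0) + h *: e2)) <=
    pinching (la (u0, t0)) (lb (u0, t0)).
  have -> : e2 = (r *: 'e_0 + s *: 'e_1, 0).
    by rewrite [LHS](_ : _ = (r *: 'e_0 + s *: 'e_1, r *: 0 + s *: 0))// !scaler0 addr0.
  exact: spatial.
have [c [jc c0]] := pinching_core oO Oz Cy geo fr1 fr2 fr3 B11 B12 B22 lneq max1 max2.
exists c; split=> //; apply: (eq_rect _ (fun g => jet g c) jc); apply/funext => h.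
by rewrite [(u0, t0) + _](_ : _ = (u0 + h *: 0, t0 + h * 1))// scaler0 addr0 mulr1.
Qed.

Hypothesis hS : closed_surface S.

(** Near a point of S, the quantity is the composite of the inverse of a
    parametrization and a function of the parameters and time, to which the closure
    properties of continuity apply. *)
Lemma pinching_continuous :
  {within [set z : 'rV[R]_3 * R | S z.1 /\ 0 <= z.2 < T],
    continuous (fun z : 'rV[R]_3 * R => w z.2 z.1)}.
Proof.
apply/subspace_continuousP => -[x t] /= [Sx tT].
have [_ _ _ emb] := hS.
have [U [phi [lp [u Uu phiu]]]] := emb x Sx.
have [Q [Y [oQ Qz CY QU XY]]] := local_flow hXsmooth lp Uu tT.
have [oU [W [oW [psi [sphi spsi Uphi Spsi]]]]] := lp.
have [[_ Wx] psiu] := Uphi u Uu; rewrite phiu in Wx psiu.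
have [B [g [oB Bx Cg psig]]] := spsi x (conj Sx Wx).
have gx : g x = u by rewrite -psig.
pose D := [set z : 'rV[R]_2 * R | 0 <= z.2 < T].
pose Wf (z : 'rV[R]_2 * R) := w z.2 (phi z.1).
have fp z : Q z -> D z -> flow_point phi Y 'e_0 'e_1 z.
  exact: (chart_flow_point lp oQ CY QU XY).
have CC k (f : 'rV[R]_2 * R -> 'rV[R]_3) i : Ck k Q f ->
    (fun z => f z 0 i) @ within D (nbhs (u, t)) --> f (u, t) 0 i.
  move=> Cf; have C0 : Ck 0 Q f by elim: k Cf => // k IH /CkW.
  have cf := Ck_coord i oQ C0; exact: cvg_within_filter (cf _ Qz).
have cW : Wf @ within D (nbhs (u, t)) --> Wf (u, t).
  have Duz : D (u, t) by [].
  have geo : \forall z \near within D (nbhs (u, t)),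
      flow_point phi Y 'e_0 'e_1 z.
    by apply: filterS (open_nbhs_nbhs (conj oQ Qz)) => z; exact: fp.
  have C1 v : Ck 1 Q (fun z => 'D_v Y z) by have [_ DY] := CY 2%N; exact: DY.
  have C2 v v' : Ck 1 Q (fun z => 'D_v (fun z => 'D_v' Y z) z).
    by have [_ DY] := CY 3%N; have [_ DDY] := DY v'; exact: DDY.
  apply: (cal_pinching (within_calculus R Duz) _ geo (fp _ Qz Duz)) => i.
  - exact: (CC _ _ i (C1 ('e_0, 0))).
  - exact: (CC _ _ i (C1 ('e_1, 0))).
  - exact: (CC _ _ i (C2 ('e_0, 0) ('e_0, 0))).
  - exact: (CC _ _ i (C2 ('e_0, 0) ('e_1, 0))).
  - exact: (CC _ _ i (C2 ('e_1, 0) ('e_1, 0))).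
  - exact: (CC _ _ i (C1 (0, 1))).
set A := [set z : 'rV[R]_3 * R | _].
pose Psi (z : 'rV[R]_3 * R) : 'rV[R]_2 * R := (g z.1, z.2).
have cPsi : {for (x, t), continuous Psi}.
  apply: (@cvg_pair _ _ _ (nbhs (x, t)) (nbhs (g x)) (nbhs t)); last exact: cvg_snd.
  have cg := Cg 0%N x Bx; exact: (cvg_comp fst g (@cvg_fst _ _ (nbhs x) (nbhs t) _) cg).
have cPsiA : Psi @ within A (nbhs (x, t)) --> within D (nbhs (u, t)).
  move=> P DP; have {}DP : nbhs (u, t) (fun y => D y -> P y) := DP.
  rewrite -gx in DP; have H : nbhs (x, t) (fun y => D (Psi y) -> P (Psi y)).
    exact: (cPsi _ DP).
  have : nbhs (x, t) (fun y => A y -> P (Psi y)); last by [].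
  by apply: filterS H => z H [_ zT]; exact: H.
have E : w t x = Wf (u, t) by rewrite /Wf /= phiu.
suff : (fun z : 'rV[R]_3 * R => w z.2 z.1) @ within A (nbhs (x, t)) --> w t x by [].
rewrite E; apply: cvg_trans (cvg_comp _ _ cPsiA cW).
apply: near_eq_cvg.
have nB : \forall z \near (x, t), (B `&` W) z.1.
  have BWx : nbhs x (B `&` W).
    by apply: open_nbhs_nbhs; split=> //; exact: openI.
  exact: (@cvg_fst _ _ (nbhs x) (nbhs t) _ _ BWx).
apply: filterS nB => z [Bz Wz] [Sz _] /=.
have [_ phiK] := Spsi _ (conj Sz Wz).
by rewrite /Wf /Psi /= -psig// phiK.
Qed.
End Flow.

(** * The maximum principle on a compact set *)

Section MaximumPrinciple.
Variables (R : realType) (V : normedModType R) (T : R) (S : set V) (w : R -> V -> R).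
Hypothesis S0 : S !=set0.
Hypothesis cS : compact S.
Hypothesis w_ge0 : forall t x, 0 <= t < T -> S x -> 0 <= w t x.
Hypothesis cw : {within [set z : V * R | S z.1 /\ 0 <= z.2 < T],
    continuous (fun z : V * R => w z.2 z.1)}.
Hypothesis w_decr : forall t x, 0 < t < T -> S x -> 0 < w t x ->
  (forall y, S y -> w t y <= w t x) ->
  exists c, jet (fun s => w (t + s) x) c /\ c.1.2 <= 0.

(** The maximum over a compact cylinder.  With t1 = t2 it is the spatial maximum. *)
Lemma tilted_max (t1 t2 e : R) : 0 <= t1 -> t1 <= t2 -> t2 < T ->
  exists x t, [/\ S x, t1 <= t <= t2 & forall y s, S y -> t1 <= s <= t2 ->
    w s y - e * (s - t1) <= w t x - e * (t - t1)].
Proof.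
move=> t10 t12 t2T; pose A : set (V * R) := S `*` [set` `[t1, t2]].
have A0 : A !=set0.
  by have [x Sx] := S0; exists (x, t1); split=> //=; rewrite in_itv/= lexx.
have cA : compact A by apply: compact_setX => //; exact: segment_compact.
have AI z : A z -> S z.1 /\ 0 <= z.2 < T.
  move=> [Sz]; rewrite /= in_itv/= => /andP[z1 z2]; split=> //.
  by rewrite (le_trans t10 z1) (le_lt_trans z2 t2T).
have cf : {within A, continuous (fun z : V * R => w z.2 z.1 - e * (z.2 - t1))}.
  apply/subspace_continuousP => z Az.
  have c1 : (fun z : V * R => w z.2 z.1) @ within A (nbhs z) --> w z.2 z.1.
    have := (subspace_continuousP _ _).1 cw z (AI z Az); apply: cvg_trans.
    by apply: cvg_app; apply: within_subset => y; exact: AI.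
  have c2 : (fun z : V * R => z.2) @ within A (nbhs z) --> z.2.
    by apply: cvg_within_filter; exact: cvg_snd.
  apply: cvgB => //; apply: cvgM; first exact: cvg_cst.
  by apply: cvgB => //; exact: cvg_cst.
have [[x t] /set_mem[Sx tI] zmax] := compact_EVT_max A0 cA cf.
rewrite /= in_itv/= in tI; exists x, t; split=> // y s Sy sI.
by apply: (zmax (y, s)); rewrite inE; split=> //=; rewrite in_itv.
Qed.

(** If the maximum had grown from t1 to t2, then, with e half of the average growth
    rate, w - e (t - t1) would attain its maximum at a time t > t1, and there the
    time derivative of w would be at least e. *)
Theorem maximum_principle (t1 t2 m1 : R) (x2 : V) : 0 <= t1 -> t1 <= t2 -> t2 < T ->
  (exists2 x, S x & w t1 x = m1) -> (forall x, S x -> w t1 x <= m1) -> S x2 ->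
  w t2 x2 <= m1.
Proof.
move=> t10 t12 t2T [x1 Sx1 wx1] max1 Sx2.
have t1I : 0 <= t1 < T by rewrite t10 (le_lt_trans t12).
have m10 : 0 <= m1 by rewrite -wx1; exact: w_ge0.
rewrite leNgt; apply/negP => m12.
have {t12} t12 : t1 < t2.
  rewrite lt_neqAle t12 andbT; apply: contraTneq m12 => E.
  by rewrite -leNgt -E; exact: max1.
pose e := (w t2 x2 - m1) / (2 * (t2 - t1)).
have e0 : 0 < e by rewrite divr_gt0 ?mulr_gt0 ?subr_gt0.
have ee : e * (t2 - t1) = (w t2 x2 - m1) / 2.
  by rewrite /e; field; rewrite subr_eq0 gt_eqF.
have [x [t [Sx /andP[tt1 tt2] tmax]]] := tilted_max e t10 (ltW t12) t2T.
have big : m1 + e * (t - t1) < w t x.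
  have := tmax x2 t2 Sx2; rewrite (ltW t12) lexx ee => /(_ isT).
  by lra.
have et : 0 <= e * (t - t1) by rewrite mulr_ge0 ?subr_ge0// ltW.
have t1t : t1 < t.
  rewrite lt_neqAle tt1 andbT; apply: contraTneq big => E.
  by rewrite -leNgt -E subrr mulr0 addr0; exact: max1.
have tI : 0 < t < T by rewrite (le_lt_trans t10 t1t) (le_lt_trans tt2 t2T).
have wx0 : 0 < w t x by lra.
have [y Sy|c [jc c0]] := w_decr tI Sx wx0.
  by have := tmax y t Sy; rewrite tt1 tt2 => /(_ isT); lra.
have jl : jet (fun s => - (e * s)) (0, - e, 0).
  by exists (fun=> 0); split=> [|//|s /=]; [exact: cvg_cst|ring].
have := jet_left_max (jetD jc jl); rewrite /= => H.
suff : 0 <= c.1.2 + - e by lra.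
apply: H; near=> s.
have s0 : s < 0 by near: s; exact: nbhs_left_lt.
have st : t1 - t < s by near: s; apply: nbhs_left_gt; rewrite subr_lt0.
have := tmax x (t + s) Sx.
have -> : t1 <= t + s <= t2 by apply/andP; split; lra.
by rewrite addr0 => /(_ isT); lra.
Unshelve. all: by end_near. Qed.

End MaximumPrinciple.

Lemma pinching_ge0 (R : realType) (a b : R) : 0 < a -> 0 < b -> 0 <= pinching a b.
Proof.
move=> a0 b0; rewrite /pinching.
have p0 : 0 <= a ^+ 4 + 2 * a ^+ 3 * b + 4 * a ^+ 2 * b ^+ 2 + 2 * a * b ^+ 3 + b ^+ 4.
  by nonneg.
apply: divr_ge0; first by rewrite mulr_ge0 ?sqr_ge0.
by rewrite ltW// !mulr_gt0// addr_gt0.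
Qed.

Theorem theorem12p2 (R : realType) (T : R) (hT : 0 < T)
    (M : R -> set 'rV[R]_3)
    (S : set 'rV[R]_3) (X : R -> 'rV[R]_3 -> 'rV[R]_3)
    (nu : R -> 'rV[R]_3 -> 'rV[R]_3)
    (l1 l2 : R -> 'rV[R]_3 -> R)
    (hM : forall t, 0 <= t < T -> closed_surface (M t))
    (hS : closed_surface S)
    (hX : forall t, 0 <= t < T -> diffeomorphism S (M t) (X t))
    (hXsmooth : smooth_on [set z : 'rV[R]_3 * R | S z.1 /\ 0 <= z.2 < T]
                          (fun z => X z.2 z.1))
    (hnu : forall t, 0 <= t < T -> forall p, M t p ->
       outer_unit_normal (M t) p (nu t p))
    (hl : forall t, 0 <= t < T -> forall p, M t p ->
       principal_curvatures (M t) (nu t p) p (l1 t p) (l2 t p))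
    (hconvex : forall t, 0 <= t < T -> forall p, M t p ->
       0 < l1 t p /\ 0 < l2 t p)
    (hflow : forall t, 0 <= t < T -> forall x, S x ->
       has_derivative_within [set s | 0 <= s < T] (fun s => X s x) t
         (- ((normA2 (l1 t (X t x)) (l2 t (X t x))) ^+ 2 *: nu t (X t x)))) :
  exists m : R -> R,
    (forall t, 0 <= t < T ->
       is_max [set pinching (l1 t p) (l2 t p) | p in M t] (m t)) /\
    (forall t1 t2, 0 <= t1 -> t1 <= t2 -> t2 < T -> m t2 <= m t1).
Proof.
pose w t x := pinching (l1 t (X t x)) (l2 t (X t x)).
have [S0 cS _ emb] := hS.
have cw : {within [set z : 'rV[R]_3 * R | S z.1 /\ 0 <= z.2 < T],
    continuous (fun z : 'rV[R]_3 * R => w z.2 z.1)}.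
  exact: (pinching_continuous hX hXsmooth hnu hl hconvex hflow hS).
have XM t x : 0 <= t < T -> S x -> M t (X t x).
  by move=> tT Sx; have [g [_ _ H _]] := hX t tT; have [] := H x Sx.
have MX t p : 0 <= t < T -> M t p -> exists2 x, S x & X t x = p.
  by move=> tT Mp; have [g [_ _ _ H]] := hX t tT; have [? ?] := H p Mp; exists (g p).
have w0 t x : 0 <= t < T -> S x -> 0 <= w t x.
  by move=> tT Sx; have [] := hconvex t tT _ (XM t x tT Sx); exact: pinching_ge0.
have wd t x : 0 < t < T -> S x -> 0 < w t x -> (forall y, S y -> w t y <= w t x) ->
    exists c, jet (fun s => w (t + s) x) c /\ c.1.2 <= 0.
  move=> tT Sx wx wmax; have [U [phi [lp [u Uu phiu]]]] := emb x Sx.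
  rewrite -phiu in wmax wx *.
  apply: (interior_decrease hX hXsmooth hnu hl hconvex hflow lp Uu tT wmax).
  apply: contraTneq wx => E; rewrite -leNgt /w E /pinching subrr.
  by rewrite expr0n /= mulr0 mul0r.
have ex_max t : exists m, 0 <= t < T ->
    (exists2 x, S x & w t x = m) /\ (forall x, S x -> w t x <= m).
  have [tT|_] := boolP (0 <= t < T); last by exists 0.
  have /andP[t0 tT'] := tT.
  have [x [s [Sx sI smax]]] := @tilted_max R _ T S w S0 cS cw t t 0 t0 (lexx t) tT'.
  have E : s = t by apply/le_anti; rewrite andbC.
  exists (w t x) => _; split; first by exists x.
  move=> y Sy; have := smax y t Sy; rewrite lexx E => /(_ isT); lra.
have [m mP] := choice ex_max.
exists m; split=> [t tT|t1 t2 t10 t12 t2T].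
  have [[x Sx wx] wmax] := mP t tT; split.
    by exists (X t x); [exact: XM|exact: wx].
  by move=> _ [p Mp <-]; have [y Sy <-] := MX t p tT Mp; exact: wmax.
have t1I : 0 <= t1 < T by rewrite t10 (le_lt_trans t12).
have t2I : 0 <= t2 < T by rewrite (le_trans t10).
have [ex1 max1] := mP t1 t1I; have [[x2 Sx2 <-] _] := mP t2 t2I.
exact: (maximum_principle (w := w) S0 cS w0 cw wd t10 t12 t2T ex1 max1 Sx2).
Qed.
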